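(* Let $A$ be a self-adjoint operator with simple discrete spectrum in $H$ whose eigenvalues $\lambda_n$, $n\in I$, are separated, i.e. $\inf_{n}|\lambda_{n+1}-\lambda_n|=:d>0$ (infimum over all $n\in I$ for which $n+1 \in I$). Let $\varphi,\psi\in H$ be nonzero and let $B=A+\langle\cdot,\varphi\rangle\psi$, $\operatorname{dom}(B)=\operatorname{dom}(A)$. Then: (i) for every $\varepsilon>0$ all eigenvalues of $B$ of sufficiently large absolute value lie in the union of the $\varepsilon$-neighbourhoods of the eigenvalues of $A$ (i.e. there is $R>0$ such that every eigenvalue $\mu$ of $B$ with $|\mu|>R$ satisfies $|\mu-\lambda_n|<\varepsilon$ for some $n\in I$), and all eigenvalues of $B$ of sufficiently large absolute value are simple (of algebraic multiplicity $1$); (ii) the eigenvalues of $B$, repeated according to algebraic multiplicity, can be enumerated as $\mu_n$, $n\in I$, so that $\mu_n-\lambda_n\to0$ as $|n|\to\infty$; (iii) the geometric multiplicity of every eigenvalue of $B$ is at most $2$, and an eigenvalue $\lambda$ of $B$ can have geometric multiplicity $2$ only if $\lambda$ is an eigenvalue of $A$ and the corresponding eigenspace $\ker(A-\lambda)$ of $A$ is reducing for $B$. Moreover, for every such $A$, every $n\in\mathbb{N}$, every set $z_1,z_2,\dots,z_n$ of pairwise distinct complex numbers, and every sequence $m_1,m_2,\dots,m_n$ of natural numbers (positive integers), there exist nonzero $\varphi,\psi\in H$ such that, for each $j=1,\dots,n$, the number $z_j$ is an eigenvalue of $B=A+\langle\cdot,\varphi\rangle\psi$ of algebraic multiplicity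 $m_j$.
   Context: $H$ is a separable (infinite-dimensional, complex) Hilbert space with inner product $\langle\cdot,\cdot\rangle$, linear in the first argument. A self-adjoint operator $A$ with simple discrete spectrum is necessarily unbounded above and/or below; by considering $-A$ in place of $A$, the case when $A$ is bounded above is reduced to the case when it is bounded below. Accordingly, the spectrum of $A$ consists of real simple eigenvalues listed in increasing order as $\lambda_n$, $n\in I$, with $I=\mathbb{N}$ if $A$ is bounded below and $I=\mathbb{Z}$ otherwise. The geometric multiplicity of an eigenvalue $\lambda$ of an operator $T$ is $\dim\ker(T-\lambda)$; its algebraic multiplicity is the dimension of the root subspace $\bigcup_{k\ge1}\ker(T-\lambda)^k$, equivalently the rank of the corresponding Riesz spectral projector. *)

(* Defs.v *)
From HB Require Import structures.
From mathcomp Require Import all_boot all_order all_algebra.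
From mathcomp Require Import complex.
From mathcomp Require Import all_classical all_reals all_analysis.
Import Order.TTheory GRing.Theory Num.Theory.
Import numFieldNormedType.Exports.
Set Implicit Arguments.
Unset Strict Implicit.
Unset Printing Implicit Defensive.
Local Open Scope classical_set_scope.
Local Open Scope card_scope.
Local Open Scope complex_scope.
Local Open Scope ring_scope.

Section Operators.
Variables (K : fieldType) (V : lmodType K).

(* A possibly unbounded operator in V; the values outside the domain are
   irrelevant. *)
Record operator := Operator {
  dom : set V;
  op_fun :> V -> V;
  dom0 : dom 0;
  domP : forall a x y, dom x -> dom y -> dom (a *: x + y);
  op_linear : forall a x y, dom x -> dom y ->
    op_fun (a *: x + y) = a *: op_fun x + op_fun y }.

Definition ker (T : operator) : set V := [set x | dom T x /\ T x = 0].

Lemma opshift_subproof (T : operator) (z : K) a x y : dom T x -> dom T y ->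
  T (a *: x + y) - z *: (a *: x + y) =
  a *: (T x - z *: x) + (T y - z *: y).
Proof.
by move=> Tx Ty; rewrite op_linear// scalerDr opprD addrACA scalerBr !scalerA
  [z * a]mulrC.
Qed.

Definition opshift (T : operator) (z : K) : operator :=
  @Operator (dom T) (fun x => T x - z *: x)
    (dom0 T) (@domP T) (@opshift_subproof T z).

Definition opid : operator :=
  @Operator setT id I (fun _ _ _ _ _ => I) (fun _ _ _ _ _ => erefl).

Lemma op0 (T : operator) : T 0 = 0.
Proof.
by have := op_linear (-1) (dom0 T) (dom0 T); rewrite scaler0 addr0 scaleN1r addNr.
Qed.

Section Composition.
Variables S T : operator.

Let D : set V := [set x | dom T x /\ dom S (T x)].

Lemma opcomp_dom0 : D 0.
Proof. by split; rewrite ?op0; apply: dom0. Qed.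

Lemma opcomp_domP a x y : D x -> D y -> D (a *: x + y).
Proof.
by move=> [Tx STx] [Ty STy]; split; [exact: domP|rewrite op_linear//; exact: domP].
Qed.

Lemma opcomp_linear a x y : D x -> D y ->
  S (T (a *: x + y)) = a *: S (T x) + S (T y).
Proof. by move=> [Tx STx] [Ty STy]; rewrite !op_linear. Qed.

Definition opcomp : operator :=
  Operator opcomp_dom0 opcomp_domP opcomp_linear.

End Composition.

Definition oppow (T : operator) (k : nat) : operator := iter k (opcomp T) opid.

Definition is_eigenvalue (T : operator) (z : K) : Prop :=
  exists2 x, x != 0 & ker (opshift T z) x.

Definition root_space (T : operator) (z : K) : set V :=
  \bigcup_(k in [set k | (1 <= k)%N]) ker (oppow (opshift T z) k).

Definition has_dim (W : set V) (n : nat) : Prop :=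
  exists e : 'I_n -> V,
    [/\ forall i, W (e i),
        forall c : 'I_n -> K, \sum_i c i *: e i = 0 -> forall i, c i = 0 &
        forall x, W x -> exists c : 'I_n -> K, x = \sum_i c i *: e i].

Definition geo_mult (T : operator) (z : K) (n : nat) : Prop :=
  has_dim (ker (opshift T z)) n.

Definition alg_mult (T : operator) (z : K) (n : nat) : Prop :=
  has_dim (root_space T z) n.

Definition infinite_dimensional : Prop := forall n, ~ has_dim setT n.

(* The family (mu_n), n in I, lists the eigenvalues of T, each one repeated
   according to its (finite) algebraic multiplicity; the values of mu outside
   I are irrelevant, and a non-eigenvalue has algebraic multiplicity 0. *)
Definition enumerates_with_mult (T : operator) (I : set int) (mu : int -> K) :=
  forall z, exists2 m, alg_mult T z m & [set n | I n /\ mu n = z] #= `I_m.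

End Operators.

Section Hilbert.
Variables (R : realType) (H : completeNormedModType R[i]).
Variable ip : {dot H for Num.conj}.
Implicit Types (A T : operator H) (M : set H) (I : set int).

(* The norm of H is the one given by ip, so that (H, ip) is a Hilbert space. *)
Definition norm_from_ip : Prop := forall x : H, `|x| ^+ 2 = ip x x.

Definition separable_space : Prop :=
  exists2 D : set H, countable D & dense D.

Definition graph T : set (H * H) := [set p | dom T p.1 /\ T p.1 = p.2].

Definition adjoint_graph T : set (H * H) :=
  [set p | forall x, dom T x -> ip (T x) p.1 = ip x p.2].

Definition self_adjoint T : Prop :=
  dense (dom T) /\ adjoint_graph T = graph T.

Definition resolvent_set T : set R[i] :=
  [set z | exists S : {linear H -> H},
    [/\ continuous S,
        forall y, dom T (S y) /\ opshift T z (S y) = y &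
        forall x, dom T x -> S (opshift T z x) = x]].

Definition spectrum T : set R[i] := ~` resolvent_set T.

(* R[i]^o is R[i] with the topology of its norm. *)
Definition simple_discrete_spectrum T : Prop :=
  forall z, spectrum T z -> isolated (spectrum T : set R[i]^o) z /\ alg_mult T z 1.

Definition bounded_below T : Prop :=
  exists c : R, forall x, dom T x -> c%:C * ip x x <= ip (T x) x.

Definition bounded_above T : Prop :=
  exists c : R, forall x, dom T x -> ip (T x) x <= c%:C * ip x x.

(* The case where T is bounded above is the mirror image of the
   case where T is bounded below: if mu_n, n >= 1,
   are the eigenvalues of -T in increasing order, then those of T are
   lambda_n = - mu_(- n), n <= -1, again in increasing order. *)
Definition index_set T : set int :=
  if `[< bounded_below T >] then [set n | 1 <= n]
  else if `[< bounded_above T >] then [set n | n <= -1]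
  else setT.

Definition enumerates_increasingly T I (lam : int -> R) : Prop :=
  (forall m n, I m -> I n -> m < n -> lam m < lam n) /\
  [set z | is_eigenvalue T z] = [set (lam n)%:C | n in I].

Definition gap I (lam : int -> R) : R :=
  inf [set `|lam (n + 1) - lam n| | n in [set n | I n /\ I (n + 1)]].

Definition orthocomp M : set H := [set x | forall y, M y -> ip x y = 0].

(* dom T = (dom T :&: M) + (dom T :&: orthocomp M), where both summands are
   mapped by T into M and orthocomp M respectively. *)
Definition reducing M T : Prop :=
  [/\ closed M,
      forall x, dom T x -> exists y z,
        [/\ dom T y, M y, dom T z, orthocomp M z & x = y + z],
      forall y, dom T y -> M y -> M (T y) &
      forall z, dom T z -> orthocomp M z -> orthocomp M (T z)].

Lemma rank_one_perturbation_subproof A (phi psi : H) a x y :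
  dom A x -> dom A y ->
  A (a *: x + y) + ip (a *: x + y) phi *: psi =
  a *: (A x + ip x phi *: psi) + (A y + ip y phi *: psi).
Proof.
by move=> Ax Ay; rewrite op_linear// linearPl/= scalerDl scalerDr scalerA addrACA.
Qed.

Definition rank_one_perturbation A (phi psi : H) : operator H :=
  @Operator _ H (dom A) (fun x => A x + ip x phi *: psi)
    (dom0 A) (@domP _ _ A) (@rank_one_perturbation_subproof A phi psi).

End Hilbert.

(* Main.v *)
Require Import Defs.
From HB Require Import structures.
From mathcomp Require Import all_boot all_order all_algebra.
From mathcomp Require Import complex ring lra zify.
From mathcomp Require Import all_classical all_reals all_analysis.
Import Order.TTheory GRing.Theory Num.Theory.
Import numFieldNormedType.Exports.
Set Implicit Arguments.
Unset Strict Implicit.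
Unset Printing Implicit Defensive.
Local Open Scope classical_set_scope.
Local Open Scope card_scope.
Local Open Scope complex_scope.
Local Open Scope ring_scope.

(** Why the theorem holds.

    The eigenvectors of [A] are total ([no_eigenvector_trivial]): on their
    orthogonal complement no real number can be an approximate eigenvalue,
    because a number isolated in the spectrum would have to be an eigenvalue
    there, and the norm of the resolvent at a real point is the inverse of the
    distance to the approximate eigenvalues. So there is an orthonormal basis
    [u] of eigenvectors, with eigenvalues [l], and [A] is exactly the maximal
    diagonal operator with entries [l] ([eigenbasis]). From then on everything
    happens in coordinates, and [l] is a sequence whose terms lie at mutual
    distance at least [d].

    Off the spectrum of [A], a number z is an eigenvalue of
    B = A + <., phi> psi iff F(z) = 1 + sum_k c_k / (l_k - z) vanishes, where
    c_k = psi_k conj phi_k. Near [l n], with [n] large, all terms but the n-th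
    add up to a small function G_n with bounded Lipschitz constant, so
    z = l_n + c_n / (1 + G_n(z)) has a solution mu_n by contraction, and
    mu_n - l_n tends to 0 ([characteristic_root]). The corresponding eigenvector
    g_n of the adjoint A + <., psi> phi satisfies |g_n - u_n| <= C |psi_n|, so
    these defects are square summable ([perturbed_pairs]).

    What remains is to count the other eigenvalues. Choose N such that the
    defects |g_n - u_n|^2 for n >= N add up to at most 1/4. The subspace
    orthogonal to all g_n with n >= N then has dimension exactly N, by a Neumann
    series; it is invariant under B, and it contains every root vector whose
    eigenvalue is not one of those mu_n. At z = mu_n the eigenvector f_n of B
    adds one dimension. The N eigenvalues of the N x N matrix of B on that
    subspace thus complete the sequence mu_n to an enumeration of all eigenvalues
    with multiplicity ([alg_mult_count], [enumeration_with_mult]). This is (ii),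
    and (i) follows from it because the l_n are separated.

    For (iii), the functional <., phi> maps an eigenspace of B into a line and its
    kernel there consists of eigenvectors of A ([geo_mult2_decouples]).

    For the last part, take phi = u_0 + ... + u_(L-1). In Lagrange coordinates the
    span of the first L basis vectors is the space of polynomials of degree less
    than L, A is multiplication by X modulo prod_k (X - l_k), and <., phi> is the
    coefficient of X^(L-1); a suitable psi replaces that modulus by any monic
    polynomial of degree L ([prescribed_alg_mult]). *)

(** * Real-valued norms *)

Section RealNorm.
Variable R : realType.

(** The order of [R[i]] is partial; taking the real part of the norm, which loses
    nothing, lets estimates take place in the ordered field [R]. *)
Definition nrm (V : normedZmodType R[i]) (x : V) : R := complex.Re `|x|.

Section Zmod.
Variable V : normedZmodType R[i].
Implicit Types x y : V.

Lemma nrmE x : `|x| = (nrm x)%:C.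
Proof. by rewrite /nrm RRe_real// ger0_real. Qed.

Lemma nrm_ge0 x : 0 <= nrm x.
Proof. by rewrite -ler0c -nrmE. Qed.

Lemma nrm0 : nrm (0 : V) = 0.
Proof. by rewrite /nrm normr0. Qed.

Lemma nrm_eq0 x : (nrm x == 0) = (x == 0).
Proof. by rewrite -(inj_eq (@complexI _)) -nrmE normr_eq0. Qed.

Lemma nrm_gt0 x : (0 < nrm x) = (x != 0).
Proof. by rewrite lt_def nrm_ge0 nrm_eq0 andbT. Qed.

Lemma nrmN x : nrm (- x) = nrm x.
Proof. by rewrite /nrm normrN. Qed.

Lemma nrmBC x y : nrm (x - y) = nrm (y - x).
Proof. by rewrite -nrmN opprB. Qed.

Lemma nrmD x y : nrm (x + y) <= nrm x + nrm y.
Proof. by rewrite -lecR rmorphD/= -!nrmE ler_normD. Qed.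

Lemma nrmB x y : nrm (x - y) <= nrm x + nrm y.
Proof. by rewrite -(nrmN y) nrmD. Qed.

Lemma nrm_dist z x y : nrm (x - y) <= nrm (x - z) + nrm (z - y).
Proof. by apply: le_trans (nrmD _ _); rewrite addrA subrK. Qed.

Lemma nrm_le0_eq0 x : nrm x <= 0 -> x = 0.
Proof. by move=> h; apply/eqP; rewrite -nrm_eq0 eq_le h nrm_ge0. Qed.

Lemma nrm_eps_eq0 x : (forall e : R, 0 < e -> nrm x <= e) -> x = 0.
Proof.
move=> h; apply: nrm_le0_eq0; apply/ler_addgt0Pr => e e0.
by rewrite add0r; exact: h.
Qed.

End Zmod.

Implicit Types a b : R[i].

Lemma nrmM a b : nrm (a * b) = nrm a * nrm b.
Proof. by apply: (@complexI R); rewrite rmorphM/= -!nrmE normrM. Qed.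

Lemma nrmV a : nrm a^-1 = (nrm a)^-1.
Proof.
have [->|a0] := eqVneq a 0; first by rewrite invr0 nrm0 invr0.
have na : nrm a != 0 by rewrite nrm_eq0.
by apply: (mulfI na); rewrite -nrmM !divff// /nrm normr1.
Qed.

Lemma nrmJ a : nrm (Num.conj a) = nrm a.
Proof. by rewrite /nrm norm_conjC. Qed.

Lemma nrmR (r : R) : nrm r%:C = `|r|.
Proof.
apply: (@complexI R); rewrite -nrmE normc_def /=.
by rewrite expr0n/= addr0 sqrtr_sqr.
Qed.

Lemma nrm1 : nrm (1 : R[i]) = 1.
Proof. by rewrite /nrm normr1. Qed.

Lemma nrm_sqrC a : (nrm a ^+ 2)%:C = a * Num.conj a.
Proof. by rewrite rmorphXn/= -nrmE normCK. Qed.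

Lemma Im_le_nrm a : `|complex.Im a| <= nrm a.
Proof.
rewrite -ler_sqr ?nnegrE ?nrm_ge0// real_normK ?num_real//.
rewrite -lecR !rmorphXn/= -nrmE -add_Re2_Im2 -rmorphXn lecR lerDr; exact: sqr_ge0.
Qed.

Lemma nrmZ (V : normedModType R[i]) a (x : V) : nrm (a *: x) = nrm a * nrm x.
Proof. by apply: (@complexI R); rewrite rmorphM/= -!nrmE normrZ. Qed.

Lemma nrm_ltC (V : normedZmodType R[i]) (x : V) (e : R) :
  (`|x| < e%:C) = (nrm x < e).
Proof. by rewrite nrmE ltcR. Qed.

Lemma ReD (a b : R[i]) : complex.Re (a + b) = complex.Re a + complex.Re b.
Proof. by case: a; case: b. Qed.

Lemma ReN (a : R[i]) : complex.Re (- a) = - complex.Re a.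
Proof. by case: a. Qed.

Lemma ReM_real (r : R) (a : R[i]) : complex.Re (r%:C * a) = r * complex.Re a.
Proof. by case: a => x y /=; rewrite mul0r subr0. Qed.

Lemma ReJ (a : R[i]) : complex.Re (Num.conj a) = complex.Re a.
Proof. by case: a. Qed.

Lemma conj_realC (r : R) : Num.conj (r%:C) = r%:C.
Proof. by rewrite /Num.conj /= oppr0. Qed.

End RealNorm.

(** * Inner products and limits *)

Section Hilbert.
Variables (R : realType) (H : completeNormedModType R[i]).
Variable ip : {dot H for Num.conj}.
Hypothesis norm_ip : norm_from_ip ip.
Implicit Types (x y z : H) (a b : R[i]).

Local Notation "''[' x , y ]" := (ip x y).

Lemma ipDl x y z : '[x + y, z] = '[x, z] + '[y, z].
Proof. exact: linearDl. Qed.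
Lemma ipNl x z : '[- x, z] = - '[x, z].
Proof. exact: linearNl. Qed.
Lemma ipBl x y z : '[x - y, z] = '[x, z] - '[y, z].
Proof. exact: linearBl. Qed.
Lemma ipZl a x z : '[a *: x, z] = a * '[x, z].
Proof. by rewrite linearZl_LR. Qed.
Lemma ip0l z : '[0, z] = 0.
Proof. exact: linear0l. Qed.
Lemma ipC x y : '[x, y] = Num.conj '[y, x].
Proof. by rewrite [LHS]hermC expr0 mul1r. Qed.
Lemma ipDr x y z : '[x, y + z] = '[x, y] + '[x, z].
Proof. exact: linearDr. Qed.
Lemma ipNr x y : '[x, - y] = - '[x, y].
Proof. exact: linearNr. Qed.
Lemma ipBr x y z : '[x, y - z] = '[x, y] - '[x, z].
Proof. exact: linearBr. Qed.
Lemma ipZr a x y : '[x, a *: y] = Num.conj a * '[x, y].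
Proof. by rewrite ipC ipZl rmorphM/= -ipC. Qed.
Lemma ip0r z : '[z, 0] = 0.
Proof. exact: linear0r. Qed.
Lemma ip_sumr (I : Type) (r : seq I) (P : pred I) (F : I -> H) z :
  '[z, \sum_(i <- r | P i) F i] = \sum_(i <- r | P i) '[z, F i].
Proof. exact: linear_sumr. Qed.
Lemma ip_suml (I : Type) (r : seq I) (P : pred I) (F : I -> H) z :
  '[\sum_(i <- r | P i) F i, z] = \sum_(i <- r | P i) '[F i, z].
Proof. exact: linear_sumlz. Qed.

Lemma ip_nrm x : '[x, x] = (nrm x ^+ 2)%:C.
Proof. by rewrite -norm_ip nrmE rmorphXn. Qed.

Lemma nrm2D x y :
  nrm (x + y) ^+ 2 = nrm x ^+ 2 + 2 * complex.Re '[x, y] + nrm y ^+ 2.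
Proof.
have -> : nrm (x + y) ^+ 2 = complex.Re '[x + y, x + y] by rewrite ip_nrm.
rewrite ipDl !ipDr !ip_nrm (ipC y x) !ReD/= ReJ; ring.
Qed.

Lemma nrm2D_ortho x y : '[x, y] = 0 ->
  nrm (x + y) ^+ 2 = nrm x ^+ 2 + nrm y ^+ 2.
Proof. by move=> h; rewrite nrm2D h /= mulr0 addr0. Qed.

Lemma nrm2B x y :
  nrm (x - y) ^+ 2 = nrm x ^+ 2 - 2 * complex.Re '[x, y] + nrm y ^+ 2.
Proof. by rewrite nrm2D ipNr ReN nrmN mulrN. Qed.

Lemma cauchy_schwarz x y : nrm '[x, y] <= nrm x * nrm y.
Proof.
have [->|y0] := eqVneq y 0; first by rewrite ip0r !nrm0 mulr0.
have ny : 0 < nrm y by rewrite nrm_gt0.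
(* |y|^2 x - <x, y> y is |y|^2 times the component of x orthogonal to y *)
have := sqr_ge0 (nrm ((nrm y ^+ 2)%:C *: x - '[x, y] *: y)).
have -> : nrm ((nrm y ^+ 2)%:C *: x - '[x, y] *: y) ^+ 2 =
    nrm y ^+ 2 * ((nrm x * nrm y) ^+ 2 - nrm '[x, y] ^+ 2).
  apply: (@complexI R); rewrite -(ip_nrm (_ - _)) ipBl !ipBr !ipZl !ipZr !ip_nrm.
  rewrite conj_realC (ipC y x) !rmorphM rmorphB/= nrm_sqrC !rmorphXn !rmorphM/=.
  ring.
rewrite pmulr_rge0 ?exprn_gt0// subr_ge0 ler_sqr// nnegrE ?mulr_ge0 ?nrm_ge0//.
Qed.

Definition tends_to (s : nat -> H) l :=
  forall e : R, 0 < e -> exists N, forall n, (N <= n)%N -> nrm (s n - l) < e.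

Lemma cauchy_tends_to (s : nat -> H) :
  (forall e : R, 0 < e -> exists N, forall m n,
    (N <= m)%N -> (N <= n)%N -> nrm (s m - s n) < e) ->
  exists l, tends_to s l.
Proof.
move=> cs; have /cauchy_cvgP/cvg_ex[l sl] : cauchy (s @ \oo).
  apply/cauchy_ballP => e e0; near_simpl.
  have eE : e = (complex.Re e)%:C by rewrite RRe_real// gtr0_real.
  have [] := cs (complex.Re e); first by rewrite -ltcR -eE.
  move=> N hN; exists ([set n | (N <= n)%N], [set n | (N <= n)%N]).
    by split; exists N.
  move=> [m n] /= [Nm Nn]; rewrite -ball_normE /ball_/= eE nrm_ltC; exact: hN.
exists l => e e0.
have := sl; move/cvgrPdist_lt => /(_ e%:C); rewrite ltcR => /(_ e0)[N _ hN].
by exists N => n Nn; rewrite -nrm_ltC distrC; exact: hN.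
Qed.

Lemma tends_to_unique s l l' : tends_to s l -> tends_to s l' -> l = l'.
Proof.
move=> sl sl'; apply/eqP; rewrite -subr_eq0; apply/eqP/nrm_eps_eq0 => e e0.
have e2 : 0 < e / 2 by lra.
have [N hN] := sl _ e2; have [N' hN'] := sl' _ e2.
have := hN (maxn N N'); rewrite leq_maxl => /(_ isT).
have := hN' (maxn N N'); rewrite leq_maxr => /(_ isT).
have := nrm_dist (s (maxn N N')) l l'; rewrite (nrmBC l (s _)); lra.
Qed.

Lemma closure_nrmP (M : set H) x :
  closure M x <-> forall e : R, 0 < e -> exists2 y, M y & nrm (x - y) < e.
Proof.
split => [Mx e e0|h].
  have [|y [My xy]] := Mx (ball x e%:C).
    by apply: nbhsx_ballx; rewrite ltcR.
  by exists y => //; move: xy; rewrite -ball_normE /ball_/= nrm_ltC.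
move=> B /nbhs_ballP[e /= e0 eB].
have eE : e = (complex.Re e)%:C by rewrite RRe_real// gtr0_real.
have [|y My xy] := h (complex.Re e); first by rewrite -ltcR -eE.
by exists y; split => //; apply: eB; rewrite -ball_normE /ball_/= eE nrm_ltC.
Qed.

Lemma continuous_linear_nrm (S : {linear H -> H}) : continuous S ->
  exists2 c : R, 0 < c & forall x, nrm (S x) <= c * nrm x.
Proof.
move=> /linear_bounded_continuous/linear_boundedP/pinfty_ex_gt0[r r0 rS].
have rE : r = (complex.Re r)%:C by rewrite RRe_real// gtr0_real.
exists (complex.Re r); first by rewrite -ltcR -rE.
by move=> x; rewrite -lecR rmorphM/= -rE -!nrmE.
Qed.

(** Picard iteration from [x0]: the n-th iterate is within a fixed multiple of
    [q ^+ n] of all the later ones. *)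
Lemma contraction_fixpoint (U : set H) (f : H -> H) (q : R) x0 :
  0 <= q -> q < 1 -> U x0 ->
  (forall x, U x -> U (f x)) ->
  (forall x y, U x -> U y -> nrm (f x - f y) <= q * nrm (x - y)) ->
  (forall x, (forall e : R, 0 < e -> exists2 y, U y & nrm (x - y) < e) -> U x) ->
  exists2 x, U x & f x = x.
Proof.
move=> q0 q1 Ux0 fU fq Ucl.
pose s n := iter n f x0.
have Us n : U (s n) by elim: n => //= n; exact: fU.
pose C := nrm (s 1%N - s 0%N) / (1 - q).
have C0 : 0 <= C by rewrite divr_ge0 ?nrm_ge0// subr_ge0 ltW.
have step n : nrm (s n.+1 - s n) <= q ^+ n * nrm (s 1%N - s 0%N).
  elim: n => [|n IH]; first by rewrite expr0 mul1r.
  apply: le_trans (fq _ _ (Us n.+1) (Us n)) _.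
  by rewrite exprS -mulrA ler_wpM2l.
have dist n k : nrm (s (n + k)%N - s n) <= q ^+ n * C * (1 - q ^+ k).
  elim: k => [|k IH]; first by rewrite addn0 subrr nrm0 expr0 subrr mulr0.
  rewrite addnS; apply: le_trans (nrm_dist (s (n + k)%N) _ _) _.
  apply: le_trans (lerD (step _) IH) _.
  have -> : nrm (s 1%N - s 0%N) = C * (1 - q).
    by rewrite /C divfK// gt_eqF// subr_gt0.
  by rewrite exprD exprSr le_eqVlt; apply/orP; left; apply/eqP; ring.
have dist' n k : nrm (s (n + k)%N - s n) <= q ^+ n * C.
  apply: le_trans (dist n k) _; apply: ler_piMr.
    by rewrite mulr_ge0 ?exprn_ge0.
  by rewrite gerBl exprn_ge0.
have small e : 0 < e -> exists N, forall n, (N <= n)%N -> q ^+ n * C < e.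
  move=> e0; have [C00|C00] := eqVneq C 0.
    by exists 0%N => n _; rewrite C00 mulr0.
  have Cp : 0 < C by rewrite lt_def C00.
  have := @cvg_expr R q; rewrite ger0_norm// => /(_ q1)/cvgrPdist_lt.
  move=> /(_ (e / C)); rewrite divr_gt0// => /(_ isT)[N _ hN].
  exists N => n Nn; rewrite -ltr_pdivlMr//; have := hN n Nn.
  by rewrite /= sub0r normrN ger0_norm ?exprn_ge0.
have [l sl] : exists l, tends_to s l.
  apply: cauchy_tends_to => e e0.
  have [|N hN] := small (e / 2); first by rewrite divr_gt0.
  exists N => m n Nm Nn.
  have := nrm_dist (s N) (s m) (s n); rewrite (nrmBC (s N)).
  have := dist' N (m - N)%N; have := dist' N (n - N)%N; rewrite !subnKC//.
  have := hN N (leqnn N); lra.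
have Ul : U l.
  apply: Ucl => e /sl[N hN]; exists (s N); first exact: Us.
  by rewrite nrmBC; exact: hN.
exists l => //; apply: (tends_to_unique _ sl) => e e0.
have [N hN] := sl _ e0; exists N.+1 => -[//|n] Nn.
apply: le_lt_trans (fq _ _ (Us n) Ul) _; apply: le_lt_trans (hN n Nn).
by rewrite ler_piMl ?nrm_ge0// ltW.
Qed.

End Hilbert.

(** * Totality of the eigenvectors *)

Section Completeness.
Variables (R : realType) (H : completeNormedModType R[i]).
Variable ip : {dot H for Num.conj}.
Hypothesis norm_ip : norm_from_ip ip.
Local Notation "''[' x , y ]" := (ip x y).
Local Notation rip x y := (complex.Re '[x, y]).
Variable A : operator H.
Hypothesis A_sym : forall x y, dom A x -> dom A y -> '[A x, y] = '[x, A y].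
Implicit Types (x y v w : H) (z : R[i]) (m s t lambda r c : R).

Lemma shift_sym x y lambda : dom A x -> dom A y ->
  '[A x - lambda%:C *: x, y] = '[x, A y - lambda%:C *: y].
Proof. by move=> Ax Ay; rewrite ipBl ipBr ipZl ipZr conj_realC A_sym. Qed.

Lemma resolvent_sym (S : {linear H -> H}) m :
  (forall y, dom A (S y) /\ opshift A m%:C (S y) = y) ->
  forall x y, '[S x, y] = '[x, S y].
Proof.
move=> hS x y; have [Sx ex] := hS x; have [Sy ey] := hS y.
by rewrite -[in LHS]ey -[in RHS]ex /= shift_sym.
Qed.

(** [K] stands for the orthogonal complement of a family of eigenvectors. All
    estimates are restricted to [K]. *)
Variable K : set H.
Hypothesis K_lin : forall z x y, K x -> K y -> K (z *: x + y).
Hypothesis K_closed : forall x,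
  (forall e : R, 0 < e -> exists2 y, K y & nrm (x - y) < e) -> K x.
Hypothesis K0 : K 0.
Hypothesis K_A : forall x, dom A x -> K x -> K (A x).
Hypothesis K_resolvent : forall m (S : {linear H -> H}),
  (forall y, dom A (S y) /\ opshift A m%:C (S y) = y) ->
  forall x, K x -> K (S x).

Lemma K_add x y : K x -> K y -> K (x + y).
Proof. by move=> Kx Ky; rewrite -[x]scale1r; exact: K_lin. Qed.

Lemma K_scale z x : K x -> K (z *: x).
Proof. by move=> Kx; rewrite -[_ *: _]addr0; exact: K_lin. Qed.

Lemma K_sub x y : K x -> K y -> K (x - y).
Proof. by move=> Kx Ky; rewrite -scaleN1r; apply: K_add => //; exact: K_scale. Qed.

(** [m] is not in the approximate point spectrum of [A] on [K]. *)
Definition bounded_below_at m := exists2 c : R, 0 < c &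
  forall y, dom A y -> K y -> c * nrm y <= nrm (A y - m%:C *: y).

Lemma resolvent_bounded_below m : resolvent_set A m%:C -> bounded_below_at m.
Proof.
move=> [S [/continuous_linear_nrm[c c0 Sc] hS hS']].
exists c^-1; first by rewrite invr_gt0.
by move=> y Ay _; rewrite ler_pdivrMl// -[in leLHS](hS' _ Ay).
Qed.

(** With [y = S x], (A - m - 1/s) y = - (S x - s x) / s. *)
Lemma resolvent_shift_below (S : {linear H -> H}) m s :
  (forall y, dom A (S y) /\ opshift A m%:C (S y) = y) ->
  s != 0 -> bounded_below_at (m + s^-1) ->
  exists2 c : R, 0 < c & forall x, K x -> c * nrm x <= nrm (S x - s%:C *: x).
Proof.
move=> hS s0 [c c0 hc]; have as0 : 0 < `|s| by rewrite normr_gt0.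
exists (`|s| / ((c * `|s|)^-1 + 1)).
  by rewrite divr_gt0// ltr_wpDl// invr_ge0 mulr_ge0// ltW.
move=> x Kx; have [Sx ex] := hS x.
have /= := hc _ Sx (K_resolvent hS Kx).
have -> : A (S x) - (m + s^-1)%:C *: S x = (- s^-1)%:C *: (S x - s%:C *: x).
  rewrite rmorphD scalerDl opprD addrA [A (S x) - _]ex scalerBr scalerA.
  have -> : (- s^-1)%:C * s%:C = -1 :> R[i] by rewrite -rmorphM/= mulNr mulVf// rmorphN1.
  by rewrite scaleN1r opprK rmorphN scaleNr addrC.
rewrite nrmZ nrmR normrN normfV => h1.
have h2 : `|s| * nrm x <= nrm (S x) + nrm (S x - s%:C *: x).
  rewrite -nrmR -nrmZ; have := nrmB (S x) (S x - s%:C *: x).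
  by rewrite opprB addrC subrK.
have k0 : 0 < (c * `|s|)^-1 + 1 by rewrite ltr_wpDl// invr_ge0 mulr_ge0// ltW.
rewrite mulrAC ler_pdivrMr//.
apply: le_trans h2 _; rewrite mulrDr mulr1 lerD2r.
by rewrite invfM [leRHS]mulrC -mulrA ler_pdivlMl.
Qed.

(** For a symmetric [S] with norm [nu] on [K], the vectors [x] that nearly
    attain the norm satisfy (S - nu)(S + nu) x ~ 0; hence [nu] or [- nu] is an
    approximate eigenvalue. *)
Lemma norm_approximate_eigenvalue (S : {linear H -> H}) (nu : R) :
  (forall x y, '[S x, y] = '[x, S y]) -> (forall x, K x -> K (S x)) ->
  0 < nu -> (forall x, K x -> nrm (S x) <= nu * nrm x) ->
  (forall e : R, 0 < e -> exists x, [/\ K x, nrm x <= 1 & nu - e < nrm (S x)]) ->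
  (exists2 c : R, 0 < c & forall x, K x -> c * nrm x <= nrm (S x - nu%:C *: x)) ->
  (exists2 c : R, 0 < c &
     forall x, K x -> c * nrm x <= nrm (S x - (- nu)%:C *: x)) ->
  False.
Proof.
move=> Ssym SK nu0 Sle Sge [c1 c10 h1] [c2 c20 h2].
have nu0' := ltW nu0; pose kappa := (c1 * c2) ^+ 2.
have kappa0 : 0 < kappa by rewrite exprn_gt0 ?mulr_gt0.
have key x : K x -> nrm x <= 1 -> (kappa + nu ^+ 4) * nrm (S x) ^+ 2 <= nu ^+ 6.
  move=> Kx x1; set sx := nrm (S x).
  have sx0 : 0 <= sx by exact: nrm_ge0.
  have Ks : K (S x - (- nu)%:C *: x) by apply: K_sub; [exact: SK|exact: K_scale].
  have w2 : nrm (S (S x) - (nu ^+ 2)%:C *: x) ^+ 2 <= nu ^+ 2 * (nu ^+ 2 - sx ^+ 2).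
    rewrite (nrm2B norm_ip) ipZr conj_realC ReM_real Ssym (ip_nrm norm_ip)/= -/sx.
    rewrite nrmZ nrmR ger0_norm ?sqr_ge0//.
    have : nrm (S (S x)) ^+ 2 <= (nu * sx) ^+ 2.
      by rewrite ler_sqr ?nnegrE ?nrm_ge0 ?mulr_ge0 // Sle//; exact: SK.
    have : (nu ^+ 2 * nrm x) ^+ 2 <= (nu ^+ 2) ^+ 2.
      rewrite ler_sqr ?nnegrE ?mulr_ge0 ?nrm_ge0 ?sqr_ge0//.
      by rewrite ler_piMr// sqr_ge0.
    rewrite !exprMn => p1 p2; lra.
  have w1 : kappa * nrm x ^+ 2 <= nrm (S (S x) - (nu ^+ 2)%:C *: x) ^+ 2.
    have -> : S (S x) - (nu ^+ 2)%:C *: x =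
        S (S x - (- nu)%:C *: x) - nu%:C *: (S x - (- nu)%:C *: x).
      have -> : (- nu)%:C *: x = - (nu%:C *: x) by rewrite rmorphN scaleNr.
      rewrite opprK linearD/= [S (nu%:C *: x)]linearZ/= scalerDr scalerA -rmorphM/= -expr2.
      by rewrite opprD addrA addrK.
    have c12 : 0 <= c1 * c2 by rewrite ltW// mulr_gt0.
    rewrite /kappa -exprMn ler_sqr ?nnegrE ?nrm_ge0//; last first.
      by rewrite mulr_ge0 ?nrm_ge0.
    apply: le_trans (h1 _ Ks); rewrite -mulrA ler_wpM2l ?(ltW c10)//; exact: h2.
  have w3 : sx ^+ 2 <= nu ^+ 2 * nrm x ^+ 2.
    by rewrite -exprMn ler_sqr ?nnegrE ?mulr_ge0 ?nrm_ge0 // Sle.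
  have : kappa * sx ^+ 2 <= nu ^+ 2 * (nu ^+ 2 * (nu ^+ 2 - sx ^+ 2)).
    apply: le_trans (_ : kappa * (nu ^+ 2 * nrm x ^+ 2) <= _).
      by rewrite ler_wpM2l// ltW.
    by rewrite mulrCA ler_wpM2l ?sqr_ge0// (le_trans w1).
  have -> : nu ^+ 6 = nu ^+ 2 * (nu ^+ 2 * nu ^+ 2) by ring.
  have -> : nu ^+ 4 = nu ^+ 2 * nu ^+ 2 by ring.
  rewrite !mulrBr mulrDl !mulrA => p; lra.
(* [key] keeps |S x| below nu q for some q < 1, against the choice of nu *)
pose q := Num.sqrt (nu ^+ 4 / (kappa + nu ^+ 4)).
have n4 : 0 < nu ^+ 4 by rewrite exprn_gt0.
have kn : 0 < kappa + nu ^+ 4 by rewrite addr_gt0.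
have q2 : q ^+ 2 = nu ^+ 4 / (kappa + nu ^+ 4).
  by rewrite sqr_sqrtr// divr_ge0// ltW.
have q0 : 0 <= q by exact: sqrtr_ge0.
have q1 : q < 1.
  rewrite -(@ltr_pXn2r _ 2)// ?nnegrE// expr1n q2 ltr_pdivrMr// mul1r.
  by rewrite ltrDr.
have [|x [Kx x1 hx]] := Sge (nu * (1 - q)).
  by rewrite mulr_gt0// subr_gt0.
have {}hx : nu * q < nrm (S x) by lra.
have := key _ Kx x1; rewrite -ler_pdivlMl//; apply/negP; rewrite -ltNge.
apply: le_lt_trans (_ : (nu * q) ^+ 2 < _).
  by rewrite exprMn q2 le_eqVlt; apply/orP; left; apply/eqP; field; rewrite gt_eqF.
by rewrite ltr_pXn2r// nnegrE ?mulr_ge0// // nrm_ge0.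
Qed.

(** The distance from a real point [m] of the resolvent set to the approximate
    point spectrum of [A] in [K] is attained, being the inverse of the norm of
    the resolvent. *)
Lemma resolvent_distance m delta : resolvent_set A m%:C -> 0 < delta ->
  (forall t, `|t - m| < delta -> bounded_below_at t) ->
  forall y, dom A y -> K y -> delta * nrm y <= nrm (A y - m%:C *: y).
Proof.
move=> [S [/continuous_linear_nrm[c c0 Sc] hS hS']] d0 hd.
have Ssym := resolvent_sym hS.
have SK := K_resolvent hS.
pose E := [set r | exists x, [/\ K x, nrm x <= 1 & r = nrm (S x)]].
have hE : has_sup E.
  split; first by exists 0, 0; rewrite linear0 nrm0; split => //; rewrite nrm0.
  exists c => _ [x [Kx x1 ->]]; apply: le_trans (Sc x) _.
  by rewrite ler_piMr// ltW.
pose nu := sup E.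
have Sle x : K x -> nrm (S x) <= nu * nrm x.
  move=> Kx; have [->|x0] := eqVneq x 0; first by rewrite linear0 !nrm0 mulr0.
  have nx : 0 < nrm x by rewrite nrm_gt0.
  rewrite -ler_pdivrMr//; apply: (sup_upper_bound hE).
  exists ((nrm x)^-1%:C *: x); split; first exact: K_scale.
    by rewrite nrmZ nrmR ger0_norm ?invr_ge0 ?nrm_ge0// mulVf// gt_eqF.
  by rewrite linearZ/= nrmZ nrmR ger0_norm ?invr_ge0 ?nrm_ge0// mulrC.
have nule : nu <= delta^-1.
  rewrite leNgt; apply/negP => lt; have nu0 : 0 < nu.
    by apply: lt_trans lt; rewrite invr_gt0.
  have ilt : nu^-1 < delta by rewrite -[delta]invrK ltf_pV2// ?posrE ?invr_gt0.
  apply: (@norm_approximate_eigenvalue S nu) => //.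
  - move=> e e0; have [_ [x [Kx x1 ->]] h] := sup_adherent e0 hE.
    by exists x; split.
  - apply: (@resolvent_shift_below S m); [done|by rewrite gt_eqF|apply: hd].
    by rewrite addrC addKr ger0_norm// invr_ge0 ltW.
  - apply: (@resolvent_shift_below S m); [done|by rewrite oppr_eq0 gt_eqF|apply: hd].
    by rewrite addrC addKr invrN normrN ger0_norm// invr_ge0 ltW.
move=> y Ay Ky.
have Kz : K (A y - m%:C *: y) by apply: K_sub; [exact: K_A|exact: K_scale].
have := Sle _ Kz; rewrite (hS' _ Ay) => h.
rewrite -ler_pdivlMl//; apply: le_trans h _.
by rewrite ler_wpM2r ?nrm_ge0.
Qed.

Hypothesis no_eigenvector : forall lambda x,
  dom A x -> K x -> A x = lambda%:C *: x -> x = 0.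
Hypothesis isolated_spectrum : forall lambda, ~ resolvent_set A lambda%:C ->
  exists2 rho : R, 0 < rho &
  forall t, t != lambda -> `|t - lambda| < rho -> resolvent_set A t%:C.

(** An isolated point of the spectrum that is not an eigenvalue on [K] does not
    belong to the approximate point spectrum on [K]. With [T = A - lambda], the
    distance formula at the two points lambda +- r gives |T y|^2 >= 2 r |<T y, y>|,
    so that [N = T (T + r)^-1] is positive with N <= 3/2 N^2; this
    bounds [N] from below on its range, and the range is dense because [N] is
    injective. *)
Lemma isolated_bounded_below lambda : bounded_below_at lambda.
Proof.
have [/resolvent_bounded_below//|] := pselect (resolvent_set A lambda%:C).
move=> /isolated_spectrum[rho rho0 hrho].
pose r := rho / 3.
have r0 : 0 < r by rewrite divr_gt0.
pose T y := A y - lambda%:C *: y.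
have resolv t : t != 0 -> `|t| < rho -> resolvent_set A (lambda + t)%:C.
  move=> t0 tr; apply: hrho; last by rewrite addrC addKr.
  by rewrite -subr_eq0 addrC addKr.
have dist t y : `|t| = r -> dom A y -> K y ->
    2 * t * rip (T y) y <= nrm (T y) ^+ 2.
  move=> tr Ay Ky; have t0 : t != 0 by rewrite -normr_gt0 tr.
  have h : r * nrm y <= nrm (T y - t%:C *: y).
    have -> : T y - t%:C *: y = A y - (lambda + t)%:C *: y.
      by rewrite /T rmorphD scalerDl opprD addrA.
    apply: resolvent_distance => //; first by apply: resolv => //; rewrite tr /r; lra.
    move=> s hs; apply: resolvent_bounded_below.
    have -> : s = lambda + (s - lambda) by rewrite addrC subrK.
    have hs' : `|(s - lambda) - t| < r by rewrite -addrA -opprD.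
    apply: resolv.
      apply/negP => /eqP e; move: hs'; rewrite e sub0r normrN tr ltxx//.
    have := ler_normD ((s - lambda) - t) t; rewrite subrK tr /r; move: hs'.
    rewrite /r => p1 p2; lra.
  have : (r * nrm y) ^+ 2 <= nrm (T y - t%:C *: y) ^+ 2.
    by rewrite ler_sqr ?nnegrE ?mulr_ge0 ?nrm_ge0// ltW.
  rewrite (nrm2B norm_ip) ipZr conj_realC ReM_real nrmZ nrmR tr => p; lra.
have Ty2 y : dom A y -> K y -> r * `|rip (T y) y| <= nrm (T y) ^+ 2 / 2.
  move=> Ay Ky; have rr : `|r| = r by rewrite gtr0_norm.
  have nr : `|- r| = r by rewrite normrN rr.
  have p1 := dist _ _ rr Ay Ky; have p2 := dist _ _ nr Ay Ky.
  by case: (ger0P (rip (T y) y)) => _; lra.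
have [||S [/continuous_linear_nrm[c c0 Sc] hS hS']] := resolv (- r).
- by rewrite oppr_eq0 gt_eqF.
- rewrite normrN (gtr0_norm r0) /r; lra.
have SK := K_resolvent hS.
have Ssym := resolvent_sym hS.
pose N x := x - r%:C *: S x.
have NE x : N x = T (S x).
  have [_ e] := hS x; rewrite /N -{1}e /= -addrA -opprD -scalerDl -rmorphD/=.
  by rewrite subrK.
have SE x : x = T (S x) + r%:C *: S x by rewrite -NE /N subrK.
have NK x : K x -> K (N x) by move=> Kx; apply: K_sub => //; apply/K_scale/SK.
have Nlin z x y : N (z *: x + y) = z *: N x + N y.
  rewrite /N linearP scalerDr scalerBr opprD addrACA; congr (_ + _).
  by rewrite !scalerA [_ * z]mulrC.
have NB x y : N (x - y) = N x - N y.
  by rewrite -[x - y]addrC -scaleN1r Nlin scaleN1r addrC.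
have Nsym x y : '[N x, y] = '[x, N y].
  by rewrite /N ipBl ipBr ipZl ipZr conj_realC Ssym.
pose C := 1 + r * c.
have C0 : 0 < C by rewrite addr_gt0// mulr_gt0.
have NC x : nrm (N x) <= C * nrm x.
  apply: le_trans (nrmB _ _) _; rewrite nrmZ nrmR gtr0_norm// mulrDl mul1r lerD2l.
  by rewrite -mulrA ler_wpM2l// ltW.
have N0 : N 0 = 0 by rewrite /N linear0 scaler0 subr0.
clearbody N.
(* with y = S x, <N x, x> = |T y|^2 + r <T y, y> *)
have Npos x : K x ->
    nrm (N x) ^+ 2 / 2 <= rip (N x) x /\ rip (N x) x <= 3 / 2 * nrm (N x) ^+ 2.
  move=> Kx; have [Sx _] := hS x; have := Ty2 _ Sx (SK _ Kx).
  have -> : rip (N x) x = nrm (N x) ^+ 2 + r * rip (T (S x)) (S x).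
    rewrite NE {2}(SE x) ipDr (ip_nrm norm_ip) ReD ipZr conj_realC ReM_real.
    by [].
  rewrite -NE; have := ler_norm (rip (N x) (S x)).
  have := ler_norm (- rip (N x) (S x)); rewrite normrN => p1 p2.
  have := ler_wpM2l (ltW r0) p1; have := ler_wpM2l (ltW r0) p2; rewrite mulrN.
  by move=> p3 p4 p5; split; lra.
(* positivity of N at x - N x *)
have Nlow x : K x -> nrm (N x) ^+ 2 <= 3 * nrm (N (N x)) ^+ 2.
  move=> Kx; have Kd := K_sub Kx (NK _ Kx).
  have [p1 _] := Npos _ Kd; have [_ p2] := Npos _ Kx.
  have [_ p3] := Npos _ (NK _ Kx).
  have p4 : 0 <= rip (N (x - N x)) (x - N x).
    by apply: le_trans p1; rewrite divr_ge0// sqr_ge0.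
  have e1 : rip (N x) (N x) = nrm (N x) ^+ 2 by rewrite (ip_nrm norm_ip).
  have e2 : rip (N (N x)) x = nrm (N x) ^+ 2 by rewrite Nsym (ip_nrm norm_ip).
  move: p4; rewrite NB ipBl !ipBr !ReD !ReN !ReD !ReN e1 e2 => p4; lra.
(* the closure of the range of N on K *)
pose U := [set v | forall e : R, 0 < e -> exists2 w, K w & nrm (v - N w) < e].
have UK v : U v -> K v.
  move=> Uv; apply: K_closed => e /Uv[w Kw h]; exists (N w) => //; exact: NK.
have UB v v' : U v -> U v' -> U (v - v').
  move=> Uv Uv' e e0; have e2 : 0 < e / 2 by rewrite divr_gt0.
  have [w Kw hw] := Uv _ e2; have [w' Kw' hw'] := Uv' _ e2.
  exists (w - w'); first exact: K_sub.
  rewrite NB opprD addrACA -opprD; apply: le_lt_trans (nrmB _ _) _; lra.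
have Ulow v : U v -> nrm v <= 2 * nrm (N v).
  move=> Uv; apply/ler_addgt0Pr => e e0.
  have [|w Kw hw] := Uv (e / (1 + 2 * C)).
    by rewrite divr_gt0// addr_gt0// mulr_gt0.
  have p1 : nrm (N w) <= 2 * nrm (N (N w)).
    rewrite -ler_sqr ?nnegrE ?mulr_ge0 ?nrm_ge0// exprMn.
    apply: le_trans (Nlow _ Kw) _; rewrite ler_wpM2r ?sqr_ge0//; lra.
  have p2 : nrm v <= nrm (v - N w) + nrm (N w).
    by have := nrmD (v - N w) (N w); rewrite subrK.
  have p3 : nrm (N (N w)) <= nrm (N v) + C * nrm (v - N w).
    apply: le_trans (_ : _ <= nrm (N v) + nrm (N (v - N w))) _; last first.
      by rewrite lerD2l.
    by rewrite NB; have := nrmB (N v) (N v - N (N w)); rewrite opprB addrC subrK.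
  have p4 : (1 + 2 * C) * nrm (v - N w) <= e.
    rewrite mulrC -ler_pdivlMr ?ltW// addr_gt0// mulr_gt0//.
  by lra.
have inU x : K x -> nrm x <= 2 * nrm (N x).
  move=> Kx.
  (* |v - N v / 2|^2 <= |v|^2 - |N v|^2 / 4 <= (1 - 1/16) |v|^2 on U, which is
     less than (31/32)^2 |v|^2 *)
  have [v Uv fv] : exists2 v, U v &
      v - (1/2)%:C *: N v + (1/2)%:C *: N x = v.
    apply: (@contraction_fixpoint _ _ U _ (31/32) 0); [lra|lra| | | |].
    - by move=> e e0; exists 0 => //; rewrite N0 subr0 nrm0.
    - move=> v Uv e e0; have [|w Kw hw] := Uv (e / (1 + C)).
        by rewrite divr_gt0// addr_gt0.
      exists (w - (1/2)%:C *: N w + (1/2)%:C *: x).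
        by apply: K_add; [apply: K_sub => //; apply/K_scale/NK|exact: K_scale].
      have -> : N (w - (1 / 2)%:C *: N w + (1 / 2)%:C *: x) =
          N w - (1/2)%:C *: N (N w) + (1/2)%:C *: N x.
        rewrite [_ + (1/2)%:C *: x]addrC Nlin NB addrC; congr (_ - _ + _).
        by rewrite -[(1/2)%:C *: N w]addr0 Nlin N0 addr0.
      have -> : v - (1 / 2)%:C *: N v + (1 / 2)%:C *: N x -
         (N w - (1 / 2)%:C *: N (N w) + (1 / 2)%:C *: N x) =
         (v - N w) - (1 / 2)%:C *: N (v - N w).
        rewrite NB scalerBr opprD addrACA subrr addr0 !opprD !opprK.
        by rewrite addrACA.
      apply: le_lt_trans (nrmB _ _) _; rewrite nrmZ nrmR ger0_norm//.
      have p1 := NC (v - N w).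
      have p4 : (1 + C) * nrm (v - N w) < e.
        by rewrite mulrC -ltr_pdivlMr// addr_gt0.
      have p5 := nrm_ge0 (N (v - N w)); lra.
    - move=> v v' Uv Uv'.
      have -> : v - (1 / 2)%:C *: N v + (1 / 2)%:C *: N x -
         (v' - (1 / 2)%:C *: N v' + (1 / 2)%:C *: N x) =
         (v - v') - (1 / 2)%:C *: N (v - v').
        rewrite NB scalerBr opprD addrACA subrr addr0 !opprD !opprK.
        by rewrite addrACA.
      have Ud := UB _ _ Uv Uv'.
      have p1 := Ulow _ Ud; have [p2 _] := Npos _ (UK _ Ud).
      rewrite -ler_sqr ?nnegrE ?mulr_ge0 ?nrm_ge0//.
      rewrite (nrm2B norm_ip) ipZr conj_realC ReM_real nrmZ nrmR ger0_norm//.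
      rewrite -Nsym; have n0 := nrm_ge0 (v - v'); have n1 := nrm_ge0 (N (v - v')).
      have p3 : nrm (v - v') ^+ 2 <= 4 * nrm (N (v - v')) ^+ 2.
        have -> : 4 * nrm (N (v - v')) ^+ 2 = (2 * nrm (N (v - v'))) ^+ 2 by ring.
        by rewrite ler_sqr ?nnegrE ?mulr_ge0.
      have n2 := sqr_ge0 (nrm (v - v')); rewrite !exprMn; lra.
    - move=> v hv e e0; have e2 : 0 < e / 2 by rewrite divr_gt0.
      have [v' Uv' h1] := hv _ e2; have [w Kw h2] := Uv' _ e2.
      exists w => //; apply: le_lt_trans (nrm_dist v' _ _) _; lra.
  have Nvx : N (x - v) = 0.
    move: fv; rewrite -addrA -[X in _ = X]addr0 => /addrI/eqP.
    rewrite addrC -scalerBr -NB.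
    rewrite scaler_eq0 -nrm_eq0 nrmR normr_eq0 => /orP[/eqP h|/eqP//].
    by exfalso; move: h; lra.
  have Kd := K_sub Kx (UK _ Uv).
  have S0 : S (x - v) = 0.
    apply: (@no_eigenvector lambda); [by have [] := hS (x - v)|exact: SK|].
    by apply/eqP; rewrite -subr_eq0 -/(T _) -NE Nvx.
  have /eqP : x - v = 0 by rewrite [x - v]SE S0 -[X in T X]S0 -NE Nvx scaler0 addr0.
  by rewrite subr_eq0 => /eqP ->; exact: Ulow.
exists (2 * c)^-1; first by rewrite invr_gt0 mulr_gt0.
move=> y Ay Ky; rewrite ler_pdivrMl ?mulr_gt0//.
have e : S (A y - (lambda - r)%:C *: y) = y by exact: hS'.
have Kx : K (A y - (lambda - r)%:C *: y) by apply: K_sub; [exact: K_A|exact: K_scale].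
have := inU _ Kx; rewrite NE e -/(T y) => p1.
have := Sc (A y - (lambda - r)%:C *: y); rewrite e => p2.
apply: le_trans p2 _; rewrite [2 * c]mulrC -mulrA ler_wpM2l// ltW//.
Qed.

(** If 0 belongs to the spectrum, it is isolated in it. *)
Lemma real_resolvent_point : exists m, resolvent_set A m%:C.
Proof.
have [|/isolated_spectrum[rho rho0 hrho]] := pselect (resolvent_set A (0 : R)%:C).
  by exists 0.
exists (rho / 2); apply: hrho; first by rewrite gt_eqF// divr_gt0.
by rewrite subr0 gtr0_norm ?divr_gt0//; lra.
Qed.

(** No real number belongs to the approximate point spectrum on [K], so the
    distance formula holds at a real point of the resolvent set with every
    [delta], and the resolvent vanishes on [K]. *)
Lemma no_eigenvector_trivial x : K x -> x = 0.
Proof.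
move=> Kx; have [m rs] := real_resolvent_point.
have [S [_ hS hS']] := rs; have [Sx ex] := hS x.
have KSx := K_resolvent hS Kx.
have Sx0 : S x = 0.
  apply: nrm_eps_eq0 => e e0.
  pose d := (nrm x + 1) / e.
  have d0 : 0 < d by rewrite divr_gt0// ltr_wpDl// nrm_ge0.
  have := @resolvent_distance _ _ rs d0 (fun t _ => isolated_bounded_below t) _ Sx KSx.
  rewrite [A (S x) - _]ex -ler_pdivlMl// => /le_trans; apply.
  rewrite /d invfM invrK mulrAC ler_piMl ?(ltW e0)// ler_pdivrMl ?mulr1 ?ler_wpDr//.
  by rewrite ltr_wpDl// nrm_ge0.
by rewrite -ex /= Sx0 op0 scaler0 subr0.
Qed.

End Completeness.

(** * Orthonormal bases and diagonal operators *)

Section OrthonormalBasis.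
Variables (R : realType) (H : completeNormedModType R[i]).
Variable ip : {dot H for Num.conj}.
Hypothesis norm_ip : norm_from_ip ip.
Local Notation "''[' x , y ]" := (ip x y).
Variable u : nat -> H.
Hypothesis u_ortho : forall i j, '[u i, u j] = (i == j)%:R.
Hypothesis u_complete : forall x, (forall k, '[x, u k] = 0) -> x = 0.
Implicit Types (x y : H) (a b : nat -> R[i]) (n k : nat) (C e : R).

Lemma nrm_u k : nrm (u k) = 1.
Proof.
apply/eqP; rewrite -(@eqrXn2 _ 2)// ?nrm_ge0// expr1n.
by rewrite -(inj_eq (@complexI R)) -(ip_nrm norm_ip) u_ortho eqxx.
Qed.

Lemma coord_ext x y : (forall k, '[x, u k] = '[y, u k]) -> x = y.
Proof.
move=> h; apply/eqP; rewrite -subr_eq0; apply/eqP/u_complete => k.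
by rewrite ipBl h subrr.
Qed.

Lemma coord_sum a m n k :
  '[\sum_(m <= i < n) a i *: u i, u k] = if (m <= k < n)%N then a k else 0.
Proof.
rewrite ip_suml; under eq_bigr do rewrite ipZl u_ortho.
rewrite (eq_bigr (fun i => if i == k then a i else 0)); last first.
  by move=> i _; case: eqP => _; rewrite ?mulr1 ?mulr0.
rewrite -big_mkcond.
have [kmn|kmn] := ifPn.
  by rewrite big_nat1_eq kmn.
by rewrite big_nat1_eq (negPf kmn).
Qed.

Lemma nrm2_sum a m n :
  nrm (\sum_(m <= i < n) a i *: u i) ^+ 2 = \sum_(m <= i < n) nrm (a i) ^+ 2.
Proof.
apply: (@complexI R); rewrite -(ip_nrm norm_ip (\sum_(m <= i < n) a i *: u i)).
rewrite ip_sumr rmorph_sum/=.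
apply: eq_big_nat => i imn.
by rewrite ipZr coord_sum imn nrm_sqrC mulrC.
Qed.

Definition partial_expansion n x := \sum_(0 <= i < n) '[x, u i] *: u i.

Lemma partial_expansion_ortho n x :
  nrm x ^+ 2 = nrm (x - partial_expansion n x) ^+ 2 +
               \sum_(0 <= i < n) nrm '[x, u i] ^+ 2.
Proof.
rewrite -nrm2_sum -[in LHS](subrK (partial_expansion n x) x).
apply: (nrm2D_ortho norm_ip).
rewrite ip_sumr big_nat_cond big1// => i; rewrite andbT => hi.
by rewrite ipZr ipBl coord_sum hi subrr mulr0.
Qed.

Lemma bessel n x : \sum_(0 <= i < n) nrm '[x, u i] ^+ 2 <= nrm x ^+ 2.
Proof. by rewrite (partial_expansion_ortho n x) lerDr sqr_ge0. Qed.

(** The partial sums come within [e] of their supremum. *)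
Lemma square_summable_tail a C :
  (forall n, \sum_(0 <= i < n) nrm (a i) ^+ 2 <= C) ->
  forall e, 0 < e -> exists N, forall m n, (N <= m)%N ->
    \sum_(m <= i < n) nrm (a i) ^+ 2 < e.
Proof.
move=> hC e e0; pose s n := \sum_(0 <= i < n) nrm (a i) ^+ 2.
have sS : has_sup (range s).
  by split; [exists (s 0%N), 0%N|exists C => _ [n _ <-]; exact: hC].
have [_ [N _ <-] hN] := sup_adherent e0 sS.
exists N => m n Nm; have [mn|nm] := leqP m n; last first.
  by rewrite big_geq// ltnW.
have sn : s n <= sup (range s) by apply: (sup_upper_bound sS); exists n.
have : s n = s N + \sum_(N <= i < m) nrm (a i) ^+ 2 + \sum_(m <= i < n) nrm (a i) ^+ 2.
  by rewrite /s (big_cat_nat (n := m)) //= (big_cat_nat (n := N)).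
have : 0 <= \sum_(N <= i < m) nrm (a i) ^+ 2.
  by apply: sumr_ge0 => i _; exact: sqr_ge0.
move: hN; rewrite -/(s N); lra.
Qed.

Lemma riesz_fischer a C : (forall n, \sum_(0 <= i < n) nrm (a i) ^+ 2 <= C) ->
  exists y, (forall k, '[y, u k] = a k) /\
    tends_to (fun n => \sum_(0 <= i < n) a i *: u i) y.
Proof.
move=> hC; pose s n := \sum_(0 <= i < n) a i *: u i.
have [y sy] : exists y, tends_to s y.
  apply: cauchy_tends_to => e e0.
  have [N hN] := square_summable_tail hC (exprn_gt0 2 e0).
  exists N => m n; wlog mn : m n / (m <= n)%N.
    move=> W Nm Nn; case/orP: (leq_total m n) => h; first exact: W.
    by rewrite nrmBC; exact: W.
  move=> Nm _; have -> : s n = s m + \sum_(m <= i < n) a i *: u i.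
    by rewrite /s -big_cat_nat.
  rewrite nrmBC addrC addKr.
  by rewrite -(@ltr_pXn2r _ 2)// ?nnegrE ?nrm_ge0 ?(ltW e0)// nrm2_sum hN.
exists y; split => // k; apply/eqP; rewrite -subr_eq0; apply/eqP.
apply: nrm_eps_eq0 => e e0; have [N hN] := sy _ e0.
have h := hN (maxn N k.+1) (leq_maxl _ _).
have ck : '[s (maxn N k.+1), u k] = a k.
  by rewrite coord_sum leq0n/= (leq_trans (leqnn k.+1)) ?leq_maxr.
rewrite -ck -ipBl; apply: le_trans (cauchy_schwarz norm_ip _ _) _.
by rewrite nrm_u mulr1 nrmBC ltW.
Qed.

Lemma expansion x : tends_to (partial_expansion^~ x) x.
Proof.
have [y [hy sy]] := riesz_fischer (fun n => bessel n x).
have yx : y = x by apply: coord_ext => k; rewrite hy.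
by rewrite -{2}yx.
Qed.

Lemma nrm_le_coord x C : 0 <= C ->
  (forall n, \sum_(0 <= i < n) nrm '[x, u i] ^+ 2 <= C ^+ 2) -> nrm x <= C.
Proof.
move=> C0 hC; apply/ler_addgt0Pr => e e0; have [N hN] := expansion x e0.
have := hN N (leqnn N); rewrite nrmBC => h.
have h2 : nrm (partial_expansion N x) <= C.
  by rewrite -ler_sqr ?nnegrE ?nrm_ge0// nrm2_sum.
have := nrmD (x - partial_expansion N x) (partial_expansion N x).
rewrite subrK; lra.
Qed.

(** Both sides have the same expansion, term by term, as sums of products of
    coordinates. *)
Lemma parseval_ext x y x' y' :
  (forall k, '[x, u k] * Num.conj '[y, u k] = '[x', u k] * Num.conj '[y', u k]) ->
  '[x, y] = '[x', y'].
Proof.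
move=> h; apply/eqP; rewrite -subr_eq0; apply/eqP.
have pe n v w : '[partial_expansion n v, w] =
    \sum_(0 <= i < n) '[v, u i] * Num.conj '[w, u i].
  by rewrite ip_suml; apply: eq_bigr => i _; rewrite ipZl -ipC.
have lim v w e : 0 < e ->
    exists N, forall n, (N <= n)%N -> nrm ('[partial_expansion n v, w] - '[v, w]) < e.
  move=> e0; have p : 0 < nrm w + 1 by rewrite ltr_wpDl// nrm_ge0.
  have [|N hN] := expansion v (e := e / (nrm w + 1)); first by rewrite divr_gt0.
  exists N => n /hN; rewrite ltr_pdivlMr// => hn; rewrite -ipBl.
  apply: le_lt_trans (cauchy_schwarz norm_ip _ _) _; apply: le_lt_trans hn.
  by rewrite ler_wpM2l ?nrm_ge0// lerDl.
apply: nrm_eps_eq0 => e e0; have e2 : 0 < e / 2 by rewrite divr_gt0.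
have [N hN] := lim x y _ e2; have [N' hN'] := lim x' y' _ e2.
have h1 := hN (maxn N N') (leq_maxl _ _).
have h2 := hN' (maxn N N') (leq_maxr _ _).
have e' : '[partial_expansion (maxn N N') x, y] =
    '[partial_expansion (maxn N N') x', y'].
  by rewrite !pe; apply: eq_bigr => i _; exact: h.
have := nrm_dist '[partial_expansion (maxn N N') x, y] '[x, y] '[x', y'].
rewrite (nrmBC '[x, y] '[partial_expansion _ x, y]).
move: h1; rewrite e'; lra.
Qed.

(** A vector with the required coordinates exists, by [riesz_fischer], when the
    entries [b] are bounded. *)
Definition diagonal b x : H := xget 0 [set y | forall k, '[y, u k] = b k * '[x, u k]].

Section Diagonal.
Variables (b : nat -> R[i]) (C : R).
Hypothesis C0 : 0 <= C.
Hypothesis bC : forall k, nrm (b k) <= C.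

Let diagonal_sum n x :
  \sum_(0 <= i < n) nrm (b i * '[x, u i]) ^+ 2 <= (C * nrm x) ^+ 2.
Proof.
apply: le_trans (_ : \sum_(0 <= i < n) C ^+ 2 * nrm '[x, u i] ^+ 2 <= _).
  apply: ler_sum => i _; rewrite nrmM exprMn ler_wpM2r ?sqr_ge0//.
  by rewrite ler_sqr ?nnegrE ?nrm_ge0.
by rewrite -mulr_sumr exprMn ler_wpM2l ?sqr_ge0// bessel.
Qed.

Lemma coord_diagonal x k : '[diagonal b x, u k] = b k * '[x, u k].
Proof.
have [y [hy _]] := riesz_fischer (fun n => diagonal_sum n x).
rewrite /diagonal; by case: xgetP => [z -> //|/(_ y)/(_ hy)].
Qed.

Lemma nrm_diagonal x : nrm (diagonal b x) <= C * nrm x.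
Proof.
apply: nrm_le_coord => [|n]; first by rewrite mulr_ge0 ?nrm_ge0.
apply: le_trans (diagonal_sum n x); apply: ler_sum => i _.
by rewrite coord_diagonal.
Qed.

Lemma diagonal_linear (a : R[i]) x y :
  diagonal b (a *: x + y) = a *: diagonal b x + diagonal b y.
Proof.
apply: coord_ext => k; rewrite !ipDl !ipZl !coord_diagonal ipDl ipZl.
by rewrite mulrDr mulrCA.
Qed.

End Diagonal.
End OrthonormalBasis.

(** * Dimension and generalized eigenspaces *)

Section FiniteDimension.
Variable K : fieldType.

Lemma row_linear_mx m n (f : 'rV[K]_m -> 'rV[K]_n) :
  (forall a x y, f (a *: x + y) = a *: f x + f y) ->
  exists P : 'M[K]_(m, n), forall c, f c = c *m P.
Proof.
move=> fl.
have f0 : f 0 = 0.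
  by have := fl (-1) 0 0; rewrite scaler0 addr0 scaleN1r addNr.
have fD x y : f (x + y) = f x + f y.
  by rewrite -[x in LHS]scale1r fl scale1r.
have fZ a x : f (a *: x) = a *: f x.
  by rewrite -[_ *: x]addr0 fl f0 addr0.
exists (\matrix_i f (delta_mx 0 i)) => c.
rewrite {1}(row_sum_delta c) mulmx_sum_row.
rewrite (big_morph f fD f0); apply: eq_bigr => i _.
by rewrite fZ rowK.
Qed.

Section HasDim.
Variable V : lmodType K.
Implicit Types W : set V.

Lemma has_dim_rowspace n (E : 'rV[K]_n -> V) (U : 'M[K]_n) W :
  (forall a x y, E (a *: x + y) = a *: E x + E y) -> (forall c, E c = 0 -> c = 0) ->
  (forall x, W x <-> exists2 c, (c <= U)%MS & x = E c) ->
  has_dim W (\rank U).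
Proof.
move=> El Ei hW.
have E0 : E 0 = 0.
  by have := El (-1) 0 0; rewrite scaler0 addr0 scaleN1r addNr.
have ED x y : E (x + y) = E x + E y by rewrite -[x in LHS]scale1r El scale1r.
have EZ a x : E (a *: x) = a *: E x by rewrite -[_ *: x]addr0 El E0 addr0.
have Esum (I : finType) (F : I -> 'rV_n) : E (\sum_i F i) = \sum_i E (F i).
  exact: (big_morph E ED E0).
have Erow (c : 'rV_(\rank U)) : \sum_i c 0 i *: E (row i (row_base U)) = E (c *m row_base U).
  by rewrite mulmx_sum_row Esum; apply: eq_bigr => i _; rewrite EZ.
exists (fun i => E (row i (row_base U))); split.
- move=> i; apply/hW; exists (row i (row_base U)) => //.
  by rewrite (submx_trans (row_sub _ _))// eq_row_base.
- move=> c hc i; pose r : 'rV_(\rank U) := \row_j c j.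
  have : E (r *m row_base U) = 0.
    by rewrite -Erow -[RHS]hc; apply: eq_bigr => j _; rewrite mxE.
  move/Ei/eqP; rewrite mulmx_free_eq0 ?row_base_free// => /eqP/rowP/(_ i).
  by rewrite !mxE.
- move=> x /hW[c cU ->].
  have /submxP[r ->] : (c <= row_base U)%MS by rewrite eq_row_base.
  by exists (r 0); rewrite Erow.
Qed.

Lemma has_dim_add_line W W' n v :
  has_dim W n -> (forall x, W x -> W' x) -> W' v ->
  (forall a, W (a *: v) -> a = 0) ->
  (forall a x y, W x -> W y -> W (a *: x + y)) ->
  (forall x, W' x -> exists a, W (x - a *: v)) ->
  has_dim W' n.+1.
Proof.
move=> [e [eW ei eg]] WW' W'v vW Wl W'g.
pose e' (i : 'I_n.+1) := if unlift ord0 i is Some j then e j else v.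
have e'0 : e' ord0 = v by rewrite /e' unlift_none.
have e'S j : e' (lift ord0 j) = e j by rewrite /e' liftK.
have W0 : W 0.
  have [a] := W'g _ W'v; rewrite -{1}[v]scale1r -scalerBl => h.
  have := Wl (-1) _ _ h h; by rewrite scaleN1r addNr.
have Wsum (c : 'I_n -> K) : W (\sum_i c i *: e i).
  apply: (big_ind W) => //.
    by move=> x y Wx Wy; rewrite -[x]scale1r; exact: Wl.
  by move=> i _; rewrite -[_ *: _]addr0; exact: Wl.
exists e'; split.
- move=> i; rewrite /e'; case: unliftP => [j _|_] //; exact: WW'.
- move=> c; rewrite big_ord_recl e'0; under eq_bigr do rewrite e'S.
  move=> hc; have c0 : c ord0 = 0.
    apply: vW; rewrite -[_ *: v]addr0 -[X in _ + X](subrr (\sum_(i < n) c (lift ord0 i) *: e i)).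
    by rewrite addrA hc add0r -scaleN1r -[_ *: _]addr0; apply: Wl.
  move: hc; rewrite c0 scale0r add0r => /ei h i.
  by case: (unliftP ord0 i) => [j ->|->].
- move=> x /W'g[a] /eg[c hc].
  exists (fun i => if unlift ord0 i is Some j then c j else a).
  rewrite big_ord_recl e'0 unlift_none.
  under eq_bigr do rewrite e'S liftK.
  by rewrite -hc addrC subrK.
Qed.

Lemma has_dim0 W : (forall x, W x -> x = 0) -> has_dim W 0.
Proof.
move=> W0; exists (fun=> 0); split.
- by case.
- by move=> c _ [].
- by move=> x /W0 ->; exists (fun=> 0); rewrite big_ord0.
Qed.

Lemma has_dim0P W : has_dim W 0 -> forall x, W x -> x = 0.
Proof. by move=> [e [_ _ h]] x /h[c ->]; rewrite big_ord0. Qed.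

Lemma has_dim1P W : has_dim W 1 ->
  exists v, [/\ W v, v != 0 & forall x, W x -> exists a, x = a *: v].
Proof.
move=> [e [eW ei eg]]; exists (e 0); split; first exact: eW.
  apply/eqP => e0; have := ei (fun=> 1); rewrite big_ord1 e0 scaler0.
  by move=> /(_ erefl 0)/eqP; rewrite oner_eq0.
by move=> x /eg[c ->]; exists (c 0); rewrite big_ord1.
Qed.

Lemma has_dim1 W v : W v -> v != 0 -> (forall x, W x -> exists a, x = a *: v) ->
  has_dim W 1.
Proof.
move=> Wv v0 h; exists (fun=> v); split => //.
- move=> c; rewrite big_ord1 => /eqP; rewrite scaler_eq0 (negPf v0) orbF => /eqP.
  by move=> c0 i; rewrite ord1.
- by move=> x /h[a ->]; exists (fun=> a); rewrite big_ord1.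
Qed.

(** The coordinates of the vectors [e i] in a basis of [W] are the linearly
    independent rows of an n x m matrix. *)
Lemma has_dim_free_le W m n (e : 'I_n -> V) : has_dim W m ->
  (forall i, W (e i)) ->
  (forall c : 'I_n -> K, \sum_i c i *: e i = 0 -> forall i, c i = 0) -> (n <= m)%N.
Proof.
move=> [b [_ _ bg]] eW ei.
have /choice[M hM] : forall i, exists c : 'I_m -> K, e i = \sum_j c j *: b j.
  by move=> i; exact: bg.
pose P : 'M[K]_(n, m) := \matrix_(i, j) M i j.
suff /eqP <- : row_free P by exact: rank_leq_col.
apply/row_freeP; apply/row_freeP; rewrite -kermx_eq0; apply/rowV0P => c.
move=> /sub_kermxP cP; apply/rowP => i; rewrite mxE; apply: ei.
rewrite (eq_bigr (fun i => \sum_j (c 0 i * M i j) *: b j)); last first.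
  by move=> k _; rewrite hM scaler_sumr; apply: eq_bigr => j _; rewrite scalerA.
rewrite exchange_big/= big1// => j _; rewrite -scaler_suml.
have /rowP/(_ j) := cP; rewrite !mxE => h.
rewrite (_ : \sum_(k < n) c 0 k * M k j = 0) ?scale0r// -[RHS]h.
by apply: eq_bigr => k _; rewrite mxE.
Qed.

Lemma has_dim_unique W m n : has_dim W m -> has_dim W n -> m = n.
Proof.
move=> hm hn; apply/eqP; rewrite eqn_leq; have [e [eW ei _]] := hm.
have [e' [eW' ei' _]] := hn.
by rewrite (has_dim_free_le hn eW ei) (has_dim_free_le hm eW' ei').
Qed.

End HasDim.
End FiniteDimension.

Section GeneralizedEigenspaces.
Variable C : closedFieldType.

(** If z is a root of order m of the characteristic polynomial q (X - z)^m, then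
    (X - z)^m is a combination of (X - z)^k and the characteristic polynomial,
    since q is prime to (X - z)^k. *)
Lemma kermx_expr_stable n (M : 'M[C]_n.+1) z k (c : 'rV_n.+1) :
  c *m (M - z%:M) ^+ k = 0 -> c *m (M - z%:M) ^+ n.+1 = 0.
Proof.
move=> ck.
have hX j : (M - z%:M) ^+ j = horner_mx M (('X - z%:P) ^+ j).
  by rewrite rmorphXn rmorphB/= horner_mx_X horner_mx_C.
have p0 : char_poly M != 0 by rewrite monic_neq0// char_poly_monic.
have [m [q]] := multiplicity_XsubC (char_poly M) z.
rewrite p0 /= => qz pE.
have q0 : q != 0 by apply: contraNneq p0 => q0; rewrite pE q0 mul0r.
have mn : (m <= n.+1)%N.
  rewrite -ltnS -(size_char_poly M) pE size_Mmonic ?monic_exp ?monicXsubC//.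
  by rewrite size_exp_XsubC addnS /= -add1n leq_add2r size_poly_gt0.
have cm : c *m (M - z%:M) ^+ m = 0.
  have : coprimep (('X - z%:P) ^+ k) q.
    by rewrite coprimep_expl// coprimep_sym coprimep_XsubC.
  move=> /Bezout_eq1_coprimepP[[a b]/= ab].
  have e : ('X - z%:P) ^+ m = ('X - z%:P) ^+ k * (a * ('X - z%:P) ^+ m) + char_poly M * b.
    by rewrite pE -{1}[LHS]mul1r -ab; ring.
  rewrite hX e rmorphD/= [horner_mx M (_ ^+ k * _)]rmorphM/= -hX.
  rewrite [horner_mx M (_ * b)]rmorphM/= Cayley_Hamilton mul0r addr0.
  by rewrite -mulmxE mulmxA ck mul0mx.
have -> : (M - z%:M) ^+ n.+1 = (M - z%:M) ^+ m * (M - z%:M) ^+ (n.+1 - m).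
  by rewrite -exprD subnKC.
by rewrite -mulmxE mulmxA cm mul0mx.
Qed.

(** The list [s] repeats each eigenvalue according to the dimension of its
    generalized eigenspace. The dimensions add up to [n.+1]: the sum of the
    generalized eigenspaces is direct, and it is everything because the product
    of the (X - a)^(n + 1) over the eigenvalues a annihilates [M]. *)
Lemma rank_geigenspaces n (M : 'M[C]_n.+1) : exists2 s : seq C, size s = n.+1 &
  forall z, \rank (kermx ((M - z%:M) ^+ n.+1)) = count_mem z s.
Proof.
have [r pE] := closed_field_poly_normal (char_poly M).
have /monicP lc := char_poly_monic M; rewrite lc scale1r in pE.
have sr : size r = n.+1.
  by apply/eqP; rewrite -eqSS -(size_prod_XsubC _ id) -pE size_char_poly.
pose rs := undup r; pose a (i : 'I_(size rs)) := rs`_i.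
have a_inj : injective a.
  by move=> i j /eqP; rewrite nth_uniq ?undup_uniq// => /eqP/val_inj.
have pD : char_poly M %| \prod_(i < size rs) ('X - (a i)%:P) ^+ n.+1.
  have -> : \prod_(i < size rs) ('X - (a i)%:P) ^+ n.+1 =
      (\prod_(z <- rs) ('X - z%:P)) ^+ size r.
    by rewrite prodrXl sr (big_nth 0) big_mkord.
  rewrite pE; have : {subset r <= rs} by move=> z; rewrite mem_undup.
  elim: (r) => [|z t IH] zt; first by rewrite big_nil dvd1p.
  rewrite big_cons exprS dvdp_mul//; last first.
    by apply: IH => y yt; apply: zt; rewrite inE yt orbT.
  by rewrite dvdp_XsubCl root_prod_XsubC; apply: zt; rewrite mem_head.
have P0 : horner_mx M (\prod_(i < size rs) ('X - (a i)%:P) ^+ n.+1) = 0.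
  by have /dvdpP[q ->] := pD; rewrite rmorphM/= Cayley_Hamilton mulr0.
have full : (\sum_(i < size rs) geigenspace M (a i) :=: 1%:M)%MS.
  apply: eqmx_trans (eqmx_sym (kermxpoly_prod M _)) _.
    move=> i j _ _ ij; rewrite coprimep_expr ?coprimep_expl//.
    by rewrite coprimep_XsubC root_XsubC (inj_eq a_inj).
  by rewrite /kermxpoly P0; exact: kermx0.
have := mxdirect_sum_geigenspace (P := xpredT) M (in2W a_inj).
move/mxdirectP => /=; rewrite full mxrank1 => sumd.
pose d z : nat := \rank (geigenspace M z).
have dE z : \rank (kermx ((M - z%:M) ^+ n.+1)) = d z by rewrite /d geigenspaceE.
have sumd' : (\sum_(z <- rs) d z)%N = n.+1 by rewrite sumd (big_nth 0) big_mkord.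
exists (flatten [seq nseq (d z) z | z <- rs]).
  rewrite size_flatten /shape -map_comp sumnE big_map -sumd'.
  by apply: eq_bigr => z _; rewrite /= size_nseq.
move=> z; rewrite dE count_flatten -map_comp sumnE big_map.
have cE y : (count_mem z \o (fun y => nseq (d y) y)) y = ((y == z) * d y)%N.
  by rewrite /= count_nseq.
under eq_bigr do rewrite cE.
have [zr|zr] := boolP (z \in rs).
  rewrite (bigD1_seq z) ?undup_uniq//= eqxx mul1n big1 ?addn0// => y /negPf ->.
  by rewrite mul0n.
rewrite big_seq big1 => [|y yr]; last first.
  by case: eqVneq => [e|_]; rewrite ?mul0n// -e yr in zr.
apply/eqP; rewrite mxrank_eq0 geigenspaceE kermx_eq0 row_free_unit unitrX//.
rewrite -[_ \is a _]/(_ \in unitmx) -row_free_unit -kermx_eq0.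
have : ~~ eigenvalue M z.
  by rewrite eigenvalue_root_char pE root_prod_XsubC -mem_undup.
by rewrite /eigenvalue negbK.
Qed.

End GeneralizedEigenspaces.

(** * Eigenvalues of the perturbation close to those of the diagonal operator *)

Section SeparatedDiagonal.
Variables (R : realType) (H : completeNormedModType R[i]).
Variable ip : {dot H for Num.conj}.
Hypothesis norm_ip : norm_from_ip ip.
Local Notation "''[' x , y ]" := (ip x y).
Variable u : nat -> H.
Hypothesis u_ortho : forall i j, '[u i, u j] = (i == j)%:R.
Hypothesis u_complete : forall x, (forall k, '[x, u k] = 0) -> x = 0.
Variables (l : nat -> R) (d : R).
Hypothesis d_gt0 : 0 < d.
Hypothesis l_sep : forall i j, i != j -> d <= `|l i - l j|.
Implicit Types (x y phi psi : H) (n k : nat) (z w : R[i]).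

(** At most one [l n] lies in each of finitely many cells of width [d] covering
    a bounded interval. *)
Lemma separated_unbounded (M : R) : exists N, forall n, (N <= n)%N -> M < `|l n|.
Proof.
pose cell n := Num.truncn ((l n + M) / d).
have cell_itv n : `|l n| <= M -> (cell n)%:R * d <= l n + M < (cell n).+1%:R * d.
  rewrite ler_norml => /andP[lM _].
  have /andP[h1 h2] : (cell n)%:R <= (l n + M) / d < (cell n).+1%:R.
    by apply: truncn_itv; rewrite divr_ge0 ?(ltW d_gt0)//; lra.
  by rewrite -ler_pdivlMr// h1 -ltr_pdivrMr.
have /choice[f hf] : forall c, exists N, forall n, `|l n| <= M -> cell n = c -> (n < N)%N.
  move=> c; have [[n0 [ln0 cn0]]|no] := pselect (exists n, `|l n| <= M /\ cell n = c).
    exists n0.+1 => n ln cn; have [->//|nn0] := eqVneq n n0.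
    have := l_sep nn0; have := cell_itv _ ln; have := cell_itv _ ln0.
    rewrite cn cn0 -addn1 natrD mulrDl mul1r.
    move=> /andP[a1 a2] /andP[a3 a4]; rewrite leNgt => /negP; case.
    by rewrite ltr_norml; apply/andP; split; lra.
  by exists 0%N => n ln cn; case: no; exists n.
exists (\sum_(c < (Num.truncn (2 * M / d)).+1) f c)%N => n.
rewrite leqNgt ltNge; apply: contra => ln.
have cb : (cell n < (Num.truncn (2 * M / d)).+1)%N.
  rewrite ltnS; apply: le_truncn; rewrite ler_pM2r ?invr_gt0//.
  by move: ln; rewrite ler_norml => /andP[]; lra.
by rewrite (bigD1 (Ordinal cb))//= ltn_addr// hf.
Qed.

(** The resolvent of the diagonal operator with entries [l] at a point [z] near
    [l n], with the nearly singular [n]-th entry replaced by [0]. *)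
Definition reduced_entry n z k : R[i] := if k == n then 0 else ((l k)%:C - z)^-1.
Definition reduced_resolvent n z x := diagonal ip u (reduced_entry n z) x.
(** The radius is half the separation [d], so [z] stays at distance at least
    [d / 2] from the other [l k]. *)
Definition in_cell n z := nrm (z - (l n)%:C) <= d / 2.

Lemma in_cell_conj n z : in_cell n z -> in_cell n (Num.conj z).
Proof. by rewrite /in_cell -[in X in _ -> X](conj_realC (l n)) -rmorphB nrmJ. Qed.

Lemma cell_dist n z k : in_cell n z -> k != n -> d / 2 <= nrm ((l k)%:C - z).
Proof.
move=> zn kn; have := nrm_dist z (l k)%:C (l n)%:C; rewrite -rmorphB nrmR.
have := l_sep kn; move: zn; rewrite /in_cell; lra.
Qed.

Lemma reduced_entry_bound n z : in_cell n z -> forall k, nrm (reduced_entry n z k) <= 2 / d.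
Proof.
move=> zn k; rewrite /reduced_entry; case: eqVneq => [_|kn].
  by rewrite nrm0 divr_ge0// ltW.
have h := cell_dist zn kn; have d2 : 0 < d / 2 by rewrite divr_gt0.
rewrite nrmV -[2 / d]invf_div lef_pV2// posrE//; lra.
Qed.

Let d2_ge0 : 0 <= 2 / d. Proof. by rewrite divr_ge0// ltW. Qed.

Lemma coord_reduced n z x k : in_cell n z ->
  '[reduced_resolvent n z x, u k] = reduced_entry n z k * '[x, u k].
Proof.
move=> zn; apply: (coord_diagonal norm_ip u_ortho d2_ge0).
exact: reduced_entry_bound.
Qed.

Lemma nrm_reduced n z x : in_cell n z -> nrm (reduced_resolvent n z x) <= 2 / d * nrm x.
Proof.
move=> zn; apply: (nrm_diagonal norm_ip u_ortho u_complete d2_ge0).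
exact: reduced_entry_bound.
Qed.

(** The sum of psi_k * conj phi_k / (l_k - z) over all [k] other than [n]. *)
Definition reduced_fun phi psi n z := '[reduced_resolvent n z psi, phi].

(** Exchanging [phi] and [psi] passes from the perturbation to its adjoint, whose
    eigenvalues are the conjugates. *)
Lemma reduced_fun_conj phi psi n z : in_cell n z ->
  reduced_fun psi phi n (Num.conj z) = Num.conj (reduced_fun phi psi n z).
Proof.
move=> zn; rewrite /reduced_fun [in RHS]ipC conjCK.
apply: (parseval_ext norm_ip u_ortho u_complete) => k.
rewrite coord_reduced; last exact: in_cell_conj.
rewrite coord_reduced// rmorphM/=.
have -> : reduced_entry n (Num.conj z) k = Num.conj (reduced_entry n z k).
  rewrite /reduced_entry; case: eqP => _; first by rewrite rmorph0.
  by rewrite [RHS]fmorphV rmorphB/= conj_realC.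
ring.
Qed.

(** Resolvent identity. *)
Lemma reduced_fun_lipschitz phi psi n z w : in_cell n z -> in_cell n w ->
  nrm (reduced_fun phi psi n z - reduced_fun phi psi n w) <=
  nrm (z - w) * ((2 / d) ^+ 2 * (nrm psi * nrm phi)).
Proof.
move=> zn wn; rewrite /reduced_fun -ipBl.
have -> : reduced_resolvent n z psi - reduced_resolvent n w psi =
    (z - w) *: reduced_resolvent n z (reduced_resolvent n w psi).
  apply: (coord_ext u_complete) => k; rewrite ipBl ipZl !coord_reduced//.
  rewrite /reduced_entry; case: eqVneq => [_|kn]; first by rewrite !mul0r mulr0 subrr.
  have nz v : in_cell n v -> (l k)%:C - v != 0.
    move=> vn; rewrite -nrm_gt0; apply: lt_le_trans (cell_dist vn kn).
    by rewrite divr_gt0.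
  by field; rewrite !nz.
apply: le_trans (cauchy_schwarz norm_ip _ _) _; rewrite nrmZ -mulrA.
rewrite ler_wpM2l ?nrm_ge0// mulrA ler_wpM2r ?nrm_ge0//.
apply: le_trans (nrm_reduced _ zn) _; rewrite expr2 -[leRHS]mulrA.
by rewrite ler_wpM2l// nrm_reduced.
Qed.

(** Split psi into its first K coordinates [p] and a small remainder [q]: for
    large [n] the cell of [l n] is far from [l 0], ..., [l (K - 1)], which makes
    the resolvent small at [p]. *)
Lemma reduced_fun_small phi psi (e : R) : 0 < e ->
  exists N, forall n z, (N <= n)%N -> in_cell n z -> nrm (reduced_fun phi psi n z) <= e.
Proof.
move=> e0; pose P := 1 + nrm phi; have P0 : 0 < P by rewrite ltr_wpDr ?nrm_ge0.
pose Q := 1 + nrm psi; have Q0 : 0 < Q by rewrite ltr_wpDr ?nrm_ge0.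
have phiP : nrm phi <= P by rewrite lerDr.
have psiQ : nrm psi <= Q by rewrite lerDr.
have eta0 : 0 < e * d / (4 * P) by rewrite divr_gt0 ?mulr_gt0.
have [K hK] := expansion norm_ip u_ortho u_complete psi eta0.
pose p := partial_expansion ip u K psi; pose q := psi - p.
have hq : nrm q < e * d / (4 * P) by rewrite /q nrmBC; exact: hK.
pose M := 2 * P * Q / e; have M0 : 0 < M by rewrite divr_gt0 ?mulr_gt0.
have [N hN] := separated_unbounded (\sum_(k < K) `|l k| + d / 2 + M).
have pQ : nrm p <= Q.
  apply: le_trans psiQ; rewrite -ler_sqr ?nnegrE ?nrm_ge0//.
  by rewrite (nrm2_sum norm_ip u_ortho) (bessel norm_ip u_ortho).
exists (maxn N K) => n z; rewrite geq_max => /andP[Nn Kn] zn.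
have lin : reduced_resolvent n z psi = reduced_resolvent n z p + reduced_resolvent n z q.
  apply: (coord_ext u_complete) => k; rewrite ipDl !coord_reduced// -mulrDr -ipDl.
  by rewrite /q addrC subrK.
have far k : (k < K)%N -> M <= nrm ((l k)%:C - z).
  move=> kK; have := hN n Nn.
  have : `|l k| <= \sum_(k < K) `|l k|.
    by rewrite (bigD1 (Ordinal kK))//= lerDl sumr_ge0.
  have := nrm_dist z (l k)%:C (l n)%:C; rewrite -rmorphB nrmR.
  have := ler_normD (l k) (l n - l k); rewrite addrC subrK distrC.
  by move: zn; rewrite /in_cell; lra.
have hRp : nrm (reduced_resolvent n z p) <= M^-1 * Q.
  have M1 : 0 <= M^-1 by rewrite invr_ge0 ltW.
  apply: (nrm_le_coord norm_ip u_ortho u_complete).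
    by rewrite mulr_ge0// ltW.
  move=> j; apply: le_trans (_ : \sum_(0 <= i < j) (M^-1) ^+ 2 * nrm '[psi, u i] ^+ 2 <= _).
    apply: ler_sum => k _; rewrite coord_reduced// nrmM exprMn.
    rewrite (coord_sum u_ortho) leq0n /=; case: ltnP => kK; last first.
      by rewrite nrm0 expr0n mulr0 mulr_ge0 ?sqr_ge0.
    rewrite ler_wpM2r ?sqr_ge0// ler_sqr ?nnegrE ?nrm_ge0//.
    rewrite /reduced_entry; case: eqP => _; first by rewrite nrm0.
    by rewrite nrmV lef_pV2 ?posrE// ?far// (lt_le_trans M0 (far _ kK)).
  rewrite -mulr_sumr exprMn ler_wpM2l ?sqr_ge0//.
  apply: le_trans (bessel norm_ip u_ortho _ _) _.
  by rewrite ler_sqr ?nnegrE ?nrm_ge0 ?(ltW Q0).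
have hRq : nrm (reduced_resolvent n z q) <= 2 / d * (e * d / (4 * P)).
  by apply: le_trans (nrm_reduced _ zn) _; rewrite ler_wpM2l// ltW.
rewrite /reduced_fun lin ipDl; apply: le_trans (nrmD _ _) _.
have h1 := cauchy_schwarz norm_ip (reduced_resolvent n z p) phi.
have h2 := cauchy_schwarz norm_ip (reduced_resolvent n z q) phi.
have h3 : nrm (reduced_resolvent n z p) * nrm phi <= M^-1 * Q * P.
  by apply: ler_pM; rewrite ?nrm_ge0.
have h4 : nrm (reduced_resolvent n z q) * nrm phi <= 2 / d * (e * d / (4 * P)) * P.
  by apply: ler_pM; rewrite ?nrm_ge0.
have e1 : M^-1 * Q * P = e / 2 by rewrite /M; field; rewrite !gt_eqF.
have e2 : 2 / d * (e * d / (4 * P)) * P = e / 2 by field; rewrite !gt_eqF.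
lra.
Qed.

Lemma coord_small x (e : R) : 0 < e ->
  exists N, forall n, (N <= n)%N -> nrm '[x, u n] <= e.
Proof.
move=> e0; have e20 : 0 < e ^+ 2 by rewrite exprn_gt0.
have [N hN] := square_summable_tail (fun n => bessel norm_ip u_ortho n x) e20.
exists N => n Nn; have := hN n n.+1 Nn; rewrite big_nat1 => h.
by rewrite -ler_sqr ?nnegrE ?nrm_ge0 ?(ltW e0)// ltW.
Qed.

(** The equation F(z) = 0 for F(z) = 1 + sum_k c_k / (l_k - z), with
    c_k = psi_k conj phi_k, multiplied by l_n - z in order to remove the pole. *)
Definition characteristic_eq phi psi n z :=
  (z - (l n)%:C) * (1 + reduced_fun phi psi n z) = '[psi, u n] * Num.conj '[phi, u n].

Lemma one_plus_half z : nrm z <= 1 / 2 -> 1 / 2 <= nrm (1 + z).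
Proof. by move=> h; have := nrmB (1 + z) z; rewrite addrK nrm1; lra. Qed.

Lemma characteristic_root_dist phi psi n z : nrm (reduced_fun phi psi n z) <= 1 / 2 ->
  characteristic_eq phi psi n z ->
  nrm (z - (l n)%:C) <= 2 * (nrm '[psi, u n] * nrm '[phi, u n]).
Proof.
move=> /one_plus_half h /(congr1 (@nrm R _)); rewrite !nrmM nrmJ => <-.
by have := ler_wpM2l (nrm_ge0 (z - (l n)%:C)) h; lra.
Qed.

(** Fixed point of z |-> l_n + c_n / (1 + G_n(z)), a contraction of the disc once
    c_n is small. The iteration takes place on the line spanned by [u 0], a copy
    of the complex plane. *)
Lemma characteristic_root phi psi : exists N, forall n, (N <= n)%N ->
  exists z, [/\ in_cell n z, nrm (reduced_fun phi psi n z) <= 1 / 2 &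
    characteristic_eq phi psi n z].
Proof.
have half0 : 0 < 1 / 2 :> R by rewrite divr_gt0.
have [N1 hN1] := reduced_fun_small phi psi half0.
pose L := (2 / d) ^+ 2 * (nrm psi * nrm phi).
have L0 : 0 <= L by rewrite mulr_ge0 ?sqr_ge0// mulr_ge0 ?nrm_ge0.
(* |psi_n| <= 1 / D makes |c_n| at most d / 4, so that the cell is mapped into
   itself, and 8 L |c_n| at most 1, so that the contraction constant is 1/2 *)
pose D := (4 / d + 8 * L + 1) * (nrm phi + 1).
have L1 : 0 < 4 / d + 8 * L + 1.
  have : 0 < 4 / d by rewrite divr_gt0.
  lra.
have phi1 : 0 < nrm phi + 1 by rewrite ltr_wpDl ?nrm_ge0.
have D0 : 0 < D by rewrite mulr_gt0.
have [N2 hN2] := coord_small psi (e := D^-1) ltac:(by rewrite invr_gt0).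
exists (maxn N1 N2) => n; rewrite geq_max => /andP[n1 n2].
pose c := '[psi, u n] * Num.conj '[phi, u n].
have hc : (4 / d + 8 * L + 1) * nrm c <= 1.
  have p1 := hN2 n n2.
  have p2 : nrm '[phi, u n] <= nrm phi + 1.
    apply: le_trans (cauchy_schwarz norm_ip _ _) _.
    by rewrite (nrm_u norm_ip u_ortho) mulr1 lerDl.
  rewrite /c nrmM nrmJ mulrC -ler_pdivlMr// mul1r.
  apply: le_trans (ler_pM (nrm_ge0 _) (nrm_ge0 _) p1 p2) _.
  rewrite /D invfM -mulrA mulVf ?mulr1//.
  by rewrite gt_eqF.
have c0 := nrm_ge0 c.
have cd : nrm c <= d / 4.
  have : 4 / d * nrm c <= 1.
    apply: le_trans hc; rewrite ler_wpM2r// -addrA lerDl.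
    by rewrite addr_ge0// mulr_ge0.
  rewrite mulrAC ler_pdivrMr// mul1r; lra.
have cL : 8 * L * nrm c <= 1.
  apply: le_trans hc; rewrite ler_wpM2r// addrAC lerDr.
  by rewrite addr_ge0// divr_ge0// ltW.
pose F z := (l n)%:C + c / (1 + reduced_fun phi psi n z).
have G2 z : in_cell n z -> 1 / 2 <= nrm (1 + reduced_fun phi psi n z).
  by move=> zn; apply: one_plus_half; exact: hN1.
have Gi z : in_cell n z -> nrm (1 + reduced_fun phi psi n z)^-1 <= 2.
  move=> /G2 h; rewrite nrmV -[leRHS]invrK lef_pV2 ?posrE//; last first.
    by rewrite (lt_le_trans half0).
  by rewrite -[2^-1]mul1r.
have Gn0 z : in_cell n z -> 1 + reduced_fun phi psi n z != 0.
  by move=> /G2 h; rewrite -nrm_gt0 (lt_le_trans half0).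
have FU z : in_cell n z -> in_cell n (F z).
  move=> zn; rewrite /in_cell /F addrC addKr nrmM.
  apply: le_trans (ler_wpM2l c0 (Gi _ zn)) _; lra.
have Fl z w : in_cell n z -> in_cell n w -> nrm (F z - F w) <= 1 / 2 * nrm (z - w).
  move=> zn wn.
  have -> : F z - F w = c * ((1 + reduced_fun phi psi n z)^-1 *
     (1 + reduced_fun phi psi n w)^-1 *
     (reduced_fun phi psi n w - reduced_fun phi psi n z)).
    by rewrite /F; field; rewrite !Gn0.
  rewrite [nrm (c * _)]nrmM [nrm (_ * (_ - _))]nrmM [nrm (_^-1 * _)]nrmM.
  have := reduced_fun_lipschitz phi psi wn zn; rewrite -/L nrmBC => p1.
  have p2 := ler_pM (nrm_ge0 _) (nrm_ge0 _) (Gi _ zn) (Gi _ wn).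
  have p3 := ler_pM (mulr_ge0 (nrm_ge0 _) (nrm_ge0 _)) (nrm_ge0 _) p2 p1.
  apply: le_trans (ler_wpM2l c0 p3) _; rewrite (nrmBC w).
  have := ler_wpM2r (nrm_ge0 (z - w)) cL; nra.
pose f x := F '[x, u 0%N] *: u 0%N.
have cu z : '[z *: u 0%N, u 0%N] = z by rewrite ipZl u_ortho eqxx mulr1.
have coord0 x : nrm '[x, u 0%N] <= nrm x.
  by have := cauchy_schwarz norm_ip x (u 0%N); rewrite (nrm_u norm_ip u_ortho) mulr1.
have [x Ux fx] : exists2 x, in_cell n '[x, u 0%N] & f x = x.
  apply: (@contraction_fixpoint _ _ [set x | in_cell n '[x, u 0%N]] f (1 / 2)
    ((l n)%:C *: u 0%N)) => /=.
  - lra.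
  - lra.
  - by rewrite cu /in_cell subrr nrm0 divr_ge0// ltW.
  - by move=> x hx; rewrite /f cu; exact: FU.
  - move=> x y hx hy; rewrite /f -scalerBl nrmZ (nrm_u norm_ip u_ortho) mulr1.
    apply: le_trans (Fl _ _ hx hy) _; rewrite ler_wpM2l// ?(ltW half0)//.
    by rewrite -ipBl.
  - move=> x hx; rewrite /in_cell; apply/ler_addgt0Pr => e /hx[y hy xy].
    have := nrm_dist '[y, u 0%N] '[x, u 0%N] (l n)%:C; rewrite -ipBl.
    have := coord0 (x - y); move: hy; rewrite /in_cell; lra.
exists '[x, u 0%N]; split => //; first exact: hN1.
have e : '[x, u 0%N] = F '[x, u 0%N] by rewrite -[in LHS]fx cu.
rewrite /characteristic_eq {1}e /F -/c addrC addKr divfK//.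
exact: Gn0.
Qed.

Section Operator.
Variable A : operator H.
Hypothesis A_coord : forall x k, dom A x -> '[A x, u k] = (l k)%:C * '[x, u k].
Hypothesis A_dom : forall x y, (forall k, '[y, u k] = (l k)%:C * '[x, u k]) ->
  dom A x /\ A x = y.

Lemma diagonal_sym x y : dom A x -> dom A y -> '[A x, y] = '[x, A y].
Proof.
move=> Ax Ay; apply: (parseval_ext norm_ip u_ortho u_complete) => k.
by rewrite !A_coord// rmorphM/= conj_realC mulrAC mulrA mulrC mulrA mulrAC mulrC mulrA.
Qed.

(** The eigenvector is f = u_n - s R_n(z) psi, where R_n is the reduced resolvent
    and s = conj phi_n / (1 + G_n(z)), which makes <f, phi> equal to s. *)
Lemma perturbed_eigenvector phi psi n z : in_cell n z ->
  nrm (reduced_fun phi psi n z) <= 1 / 2 -> characteristic_eq phi psi n z ->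
  exists f, [/\ dom A f, A f + '[f, phi] *: psi = z *: f, '[f, u n] = 1 &
    nrm (f - u n) <= 4 / d * nrm psi * nrm '[phi, u n]].
Proof.
move=> zn G12 ce; set G := reduced_fun phi psi n z in G12.
have h := one_plus_half G12.
have G0 : 1 + G != 0 by rewrite -nrm_gt0 (lt_le_trans _ h)// divr_gt0.
pose s := Num.conj '[phi, u n] / (1 + G).
pose f := u n - s *: reduced_resolvent n z psi.
have fk k : '[f, u k] = (n == k)%:R - s * (reduced_entry n z k * '[psi, u k]).
  by rewrite ipBl ipZl u_ortho coord_reduced.
have fphi : '[f, phi] = s.
  rewrite ipBl ipZl ipC -/(reduced_fun phi psi n z) -/G /s; field; exact: G0.
have [Af Afe] : dom A f /\ A f = z *: f - s *: psi.
  apply: A_dom => k; rewrite ipBl !ipZl fk /reduced_entry eq_sym.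
  case: eqVneq => [->|kn].
    rewrite !mul0r mulr0 subr0 !mulr1.
    have : z - (l n)%:C = s * '[psi, u n].
      by apply: (mulIf G0); rewrite ce /s; field; exact: G0.
    by move=> <-; rewrite opprB addrC subrK.
  have nz : (l k)%:C - z != 0.
    by rewrite -nrm_gt0; apply: lt_le_trans (cell_dist zn kn); rewrite divr_gt0.
  rewrite mulr0n; field; exact: nz.
exists f; split => //.
- by rewrite fphi Afe subrK.
- by rewrite fk /reduced_entry eqxx mul0r mulr0 subr0.
- rewrite /f addrC addKr nrmN nrmZ /s nrmM nrmJ nrmV.
  have hi : (nrm (1 + G))^-1 <= 2.
    by rewrite -[leRHS]invrK lef_pV2 ?posrE// ?nrm_gt0// -[2^-1]mul1r.
  have p1 := nrm_reduced psi zn.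
  have p2 := ler_wpM2l (nrm_ge0 '[phi, u n]) hi.
  have G1 : 0 <= (nrm (1 + G))^-1 by rewrite invr_ge0 nrm_ge0.
  have p3 := ler_pM (mulr_ge0 (nrm_ge0 '[phi, u n]) G1) (nrm_ge0 _) p2 p1.
  apply: le_trans p3 _; rewrite le_eqVlt; apply/orP; left; apply/eqP.
  by field; rewrite gt_eqF.
Qed.

(** [g] is an eigenvector of A + <., psi> phi, the formal adjoint of
    A + <., phi> psi. *)
Lemma adjoint_eigenvector phi psi g z : dom A g ->
  A g + '[g, psi] *: phi = Num.conj z *: g ->
  forall x, dom A x -> '[A x + '[x, phi] *: psi, g] = z * '[x, g].
Proof.
move=> Ag eg x Ax; rewrite ipDl ipZl diagonal_sym// (ipC _ psi g).
have -> : '[x, phi] * Num.conj '[g, psi] = '[x, '[g, psi] *: phi].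
  by rewrite ipZr mulrC.
by rewrite -ipDr eg ipZr conjCK.
Qed.

(** The bounds on [f n - u n] and [g n - u n] in [perturbed_eigenvector] are
    multiples of |phi_n| and |psi_n|: the former tends to zero and the latter is
    square summable. *)
Lemma perturbed_pairs phi psi : exists N (mu : nat -> R[i]) (f g : nat -> H),
  [/\ forall n, (N <= n)%N -> nrm (mu n - (l n)%:C) <= d / 4,
      forall e : R, 0 < e -> exists N', forall n, (N' <= n)%N -> nrm (mu n - (l n)%:C) <= e,
      forall n, (N <= n)%N -> dom A (f n) /\ A (f n) + '[f n, phi] *: psi = mu n *: f n,
      forall n x, (N <= n)%N -> dom A x ->
        '[A x + '[x, phi] *: psi, g n] = mu n * '[x, g n] &
      (forall n, (N <= n)%N -> '[f n, g n] != 0) /\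
      forall m, \sum_(N <= n < m) nrm (g n - u n) ^+ 2 <= 1 / 4].
Proof.
have [N1 hN1] := characteristic_root phi psi.
have ex n : exists t : R[i] * H * H, (N1 <= n)%N -> [/\
   nrm (t.1.1 - (l n)%:C) <= 2 * (nrm '[psi, u n] * nrm '[phi, u n]),
   dom A t.1.2 /\ A t.1.2 + '[t.1.2, phi] *: psi = t.1.1 *: t.1.2,
   dom A t.2 /\ A t.2 + '[t.2, psi] *: phi = Num.conj t.1.1 *: t.2,
   '[t.1.2, u n] = 1 /\ '[t.2, u n] = 1 &
   nrm (t.1.2 - u n) <= 4 / d * nrm psi * nrm '[phi, u n] /\
   nrm (t.2 - u n) <= 4 / d * nrm phi * nrm '[psi, u n]].
  have [n1|n1] := leqP N1 n; last by exists (0, 0, 0).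
  have [z [zn Gz ce]] := hN1 n n1.
  have [f [Af ef fu fn]] := perturbed_eigenvector zn Gz ce.
  have [||g [Ag eg gu gn]] := @perturbed_eigenvector psi phi n _ (in_cell_conj zn).
  - by rewrite reduced_fun_conj// nrmJ.
  - have := congr1 Num.conj ce; rewrite !rmorphM rmorphB rmorphD rmorph1/= conj_realC conjCK.
    by rewrite /characteristic_eq reduced_fun_conj// => ->; rewrite mulrC.
  by exists (z, f, g); split => //; exact: (characteristic_root_dist Gz).
have {ex}[t ht] := choice ex.
have lim (e : R) : 0 < e ->
    exists N', forall n, (N' <= n)%N -> nrm ((t n).1.1 - (l n)%:C) <= e.
  move=> e0; have p0 : 0 < 2 * (nrm phi + 1) by rewrite mulr_gt0// ltr_wpDl ?nrm_ge0.
  have [N2 hN2] := coord_small psi (divr_gt0 e0 p0).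
  exists (maxn N1 N2) => n; rewrite geq_max => /andP[n1 n2].
  have [h _ _ _ _] := ht n n1; apply: le_trans h _.
  have h1 := hN2 n n2.
  have h2 : nrm '[phi, u n] <= nrm phi + 1.
    apply: le_trans (cauchy_schwarz norm_ip _ _) _.
    by rewrite (nrm_u norm_ip u_ortho) mulr1 lerDl.
  have := ler_pM (nrm_ge0 _) (nrm_ge0 _) h1 h2.
  have -> : e / (2 * (nrm phi + 1)) * (nrm phi + 1) = e / 2.
    by field; rewrite gt_eqF// ltr_wpDl ?nrm_ge0.
  lra.
pose K := 1 + 4 / d * (nrm psi + nrm phi).
have d4 : 0 <= 4 / d by rewrite divr_ge0// ltW.
have K0 : 0 < K by rewrite ltr_wpDr// mulr_ge0 ?addr_ge0 ?nrm_ge0.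
have psiK : 4 / d * nrm psi <= K.
  by rewrite /K mulrDr addrCA lerDl addr_ge0// mulr_ge0 ?nrm_ge0.
have phiK : 4 / d * nrm phi <= K.
  by rewrite /K mulrDr addrA lerDr addr_ge0// mulr_ge0 ?nrm_ge0.
have [N2 hN2] := lim (d / 4) ltac:(by rewrite divr_gt0).
have K2 : 0 < (2 * K)^-1 by rewrite invr_gt0 mulr_gt0.
have [N3 hN3] := coord_small psi K2.
have [N4 hN4] := coord_small phi K2.
have K3 : 0 < (4 * K ^+ 2)^-1 by rewrite invr_gt0 mulr_gt0 ?exprn_gt0.
have [N5 hN5] := square_summable_tail (fun n => bessel norm_ip u_ortho n psi) K3.
pose N := maxn N1 (maxn N2 (maxn N3 (maxn N4 N5))).
have NE n : (N <= n)%N -> [/\ N1 <= n, N2 <= n, N3 <= n, N4 <= n & N5 <= n]%N.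
  by rewrite !geq_max => /and5P[].
have gK n : (N <= n)%N -> nrm ((t n).2 - u n) <= K * nrm '[psi, u n].
  move=> /NE[n1 _ _ _ _]; have [_ _ _ _ [_ h]] := ht n n1.
  by apply: le_trans h _; rewrite ler_wpM2r ?nrm_ge0.
exists N, (fun n => (t n).1.1), (fun n => (t n).1.2), (fun n => (t n).2); split.
- by move=> n /NE[_ n2 _ _ _]; exact: hN2.
- exact: lim.
- by move=> n /NE[n1 _ _ _ _]; have [] := ht n n1.
- move=> n x /NE[n1 _ _ _ _] Ax; have [_ _ [Ag eg] _ _] := ht n n1.
  exact: adjoint_eigenvector.
- split=> [n Nn|m].
    have [n1 _ n3 n4 _] := NE _ Nn; have [_ _ _ [fu gu] [hf _]] := ht n n1.
    have hf2 : nrm ((t n).1.2 - u n) <= 1 / 2.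
      apply: le_trans hf _; apply: le_trans (_ : K * (2 * K)^-1 <= _).
        apply: ler_pM => //; [exact: mulr_ge0 (nrm_ge0 _)|exact: nrm_ge0|exact: hN4].
      by rewrite le_eqVlt; apply/orP; left; apply/eqP; field; rewrite gt_eqF.
    have hg2 : nrm ((t n).2 - u n) <= 1 / 2.
      apply: le_trans (gK _ Nn) _; apply: le_trans (_ : K * (2 * K)^-1 <= _).
        by rewrite ler_wpM2l ?(ltW K0)// hN3.
      by rewrite le_eqVlt; apply/orP; left; apply/eqP; field; rewrite gt_eqF.
    apply/eqP => fg0; have := cauchy_schwarz norm_ip ((t n).1.2 - u n) ((t n).2 - u n).
    rewrite ipBl !ipBr fg0 fu u_ortho eqxx (ipC _ (u n)) gu rmorph1 subrr subr0 sub0r.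
    rewrite nrmN nrm1; have := ler_pM (nrm_ge0 _) (nrm_ge0 _) hf2 hg2; lra.
  apply: le_trans (_ : \sum_(N <= i < m) K ^+ 2 * nrm '[psi, u i] ^+ 2 <= _).
    rewrite big_nat_cond [leRHS]big_nat_cond; apply: ler_sum => n.
    rewrite andbT => /andP[Nn _]; rewrite -exprMn.
    by rewrite ler_sqr ?nnegrE ?nrm_ge0 ?mulr_ge0 ?nrm_ge0 ?(ltW K0)// gK.
  have [_ _ _ _ n5] := NE N (leqnn N).
  rewrite -mulr_sumr; apply: le_trans (ler_wpM2l (sqr_ge0 K) (ltW (hN5 N m n5))) _.
  by rewrite le_eqVlt; apply/orP; left; apply/eqP; field; rewrite gt_eqF.
Qed.

(** At w = i y with y large the resolvent of [A] is small, so that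
    F = 1 + <R psi, phi> is invertible and the rank-one update formula
    R x - <R x, phi> / F R psi gives the resolvent of the perturbation. *)
Lemma perturbed_resolvent phi psi (M : R) : exists w (S : H -> H),
  [/\ M < complex.Im w, forall (a : R[i]) x y, S (a *: x + y) = a *: S x + S y &
   forall x, dom A (S x) /\ A (S x) + '[S x, phi] *: psi - w *: S x = x].
Proof.
pose y := 2 * (nrm psi * nrm phi) + `|M| + 1.
have pp : 0 <= nrm psi * nrm phi by rewrite mulr_ge0 ?nrm_ge0.
have M0 : 0 <= `|M| by [].
have y0 : 0 < y by rewrite /y; lra.
pose w : R[i] := y *i; pose b k := ((l k)%:C - w)^-1.
have yb k : y <= nrm ((l k)%:C - w).
  apply: le_trans (Im_le_nrm _); rewrite /= sub0r normrN; exact: ler_norm.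
have b0 k : (l k)%:C - w != 0 by rewrite -nrm_gt0 (lt_le_trans y0).
have bC k : nrm (b k) <= y^-1.
  by rewrite /b nrmV lef_pV2 ?posrE// nrm_gt0.
have y1 : 0 <= y^-1 by rewrite invr_ge0 ltW.
pose Rw := diagonal ip u b.
have Rwk x k : '[Rw x, u k] = b k * '[x, u k] by exact: (coord_diagonal norm_ip u_ortho y1).
have Rwl : forall (a : R[i]) x x', Rw (a *: x + x') = a *: Rw x + Rw x'.
  exact: (diagonal_linear norm_ip u_ortho u_complete y1).
have ARw x : dom A (Rw x) /\ A (Rw x) = x + w *: Rw x.
  by apply: A_dom => k; rewrite ipDl ipZl Rwk /b; field; exact: b0.
pose F := 1 + '[Rw psi, phi].
have F0 : F != 0.
  rewrite -nrm_gt0; apply: lt_le_trans (_ : 1 / 2 <= _); first by rewrite divr_gt0.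
  apply: one_plus_half; apply: le_trans (cauchy_schwarz norm_ip _ _) _.
  apply: le_trans (_ : y^-1 * (nrm psi * nrm phi) <= _).
    rewrite mulrA ler_wpM2r ?nrm_ge0//.
    exact: (nrm_diagonal norm_ip u_ortho u_complete y1).
  by rewrite mulrC ler_pdivrMr// /y; lra.
exists w, (fun x => Rw x - ('[Rw x, phi] / F) *: Rw psi); split.
- by rewrite /= /y; have := ler_norm M; lra.
- move=> a x x'; rewrite Rwl ipDl ipZl mulrDl scalerDl scalerBr opprD addrACA.
  by rewrite scalerA mulrA.
- move=> x; set a := '[Rw x, phi]; have [Ax ex] := ARw x; have [Ap ep] := ARw psi.
  have -> : Rw x - (a / F) *: Rw psi = (- (a / F)) *: Rw psi + Rw x.
    by rewrite scaleNr addrC.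
  split; first exact: domP.
  rewrite op_linear// ex ep ipDl ipZl -/a.
  have -> : - (a / F) * '[Rw psi, phi] + a = a / F.
    have -> : '[Rw psi, phi] = F - 1 by rewrite /F addrC addKr.
    by field; exact: F0.
  apply: (coord_ext u_complete) => k; rewrite ipBl !ipDl !ipZl !ipDl !ipZl.
  ring.
Qed.

End Operator.
End SeparatedDiagonal.

(** * Counting the eigenvalues *)

Section RootSpaces.
Variables (K : fieldType) (V : lmodType K).
Implicit Types (T : operator V) (x y : V).

Lemma ker_oppowS T k x : ker (oppow T k) x -> ker (oppow T k.+1) x.
Proof. by move=> [dx ex]; split => /=; rewrite ?ex ?op0//; split => //; exact: dom0. Qed.

Lemma ker_oppow_le T k j x : (k <= j)%N -> ker (oppow T k) x -> ker (oppow T j) x.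
Proof.
move=> /subnKC <-; elim: (j - k)%N => [|i IH]; first by rewrite addn0.
by move=> /IH h; rewrite addnS; exact: ker_oppowS.
Qed.

Lemma ker_linear T a x y : ker T x -> ker T y -> ker T (a *: x + y).
Proof.
move=> [dx ex] [dy ey]; split; first exact: domP.
by rewrite op_linear// ex ey scaler0 addr0.
Qed.

Lemma root_space_linear T z a x y : root_space T z x -> root_space T z y ->
  root_space T z (a *: x + y).
Proof.
move=> [k /= k1 kx] [j /= j1 jy]; exists (maxn k j) => /=.
  by rewrite leq_max k1.
apply: ker_linear.
  by apply: ker_oppow_le kx; rewrite leq_maxl.
by apply: ker_oppow_le jy; rewrite leq_maxr.
Qed.

Lemma ker_root_space T z x : ker (opshift T z) x -> root_space T z x.
Proof. by move=> [dx ex]; exists 1%N => //=. Qed.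

End RootSpaces.

Lemma card_uniq_seq (T : eqType) (s : seq T) : uniq s -> [set x | x \in s] #= `I_(size s).
Proof.
case: s => [_|x0 s' us].
  have -> : [set x | x \in ([::] : seq T)] = set0 by apply/seteqP; split.
  by rewrite /= II0 card_eq00.
set s := x0 :: s' in us *.
have -> : [set x | x \in s] = nth x0 s @` `I_(size s).
  apply/seteqP; split => [x /= xs|_ [k /= ks <-]]; last exact: mem_nth.
  by exists (index x s); [have := xs; rewrite -index_mem|rewrite nth_index].
apply: inj_card_eq => i j; rewrite !inE /= => si sj /eqP.
by rewrite nth_uniq// => /eqP.
Qed.

Section Counting.
Variables (R : realType) (H : completeNormedModType R[i]).
Variable ip : {dot H for Num.conj}.
Hypothesis norm_ip : norm_from_ip ip.
Local Notation "''[' x , y ]" := (ip x y).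
Variable u : nat -> H.
Hypothesis u_ortho : forall i j, '[u i, u j] = (i == j)%:R.
Hypothesis u_complete : forall x, (forall k, '[x, u k] = 0) -> x = 0.
Variables (B : operator H) (N' : nat) (mu : nat -> R[i]) (f g : nat -> H).
Local Notation N := N'.+1.
Hypothesis f_eigen : forall n, (N <= n)%N -> dom B (f n) /\ B (f n) = mu n *: f n.
Hypothesis g_adjoint : forall n x, (N <= n)%N -> dom B x ->
  '[B x, g n] = mu n * '[x, g n].
Hypothesis fg_neq0 : forall n, (N <= n)%N -> '[f n, g n] != 0.
Hypothesis g_near : forall m, \sum_(N <= n < m) nrm (g n - u n) ^+ 2 <= 1 / 4.
Hypothesis mu_inj : forall m n, (N <= m)%N -> (N <= n)%N -> mu m = mu n -> m = n.
Variables (w : R[i]) (S : H -> H).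
Hypothesis S_linear : forall (a : R[i]) x y, S (a *: x + y) = a *: S x + S y.
Hypothesis S_resolvent : forall x, dom B (S x) /\ B (S x) - w *: S x = x.
Hypothesis w_mu : forall n, (N <= n)%N -> mu n != w.
Implicit Types (x y : H) (c : 'rV[R[i]]_N).

(** The annihilator of the far eigenvectors of the adjoint; it plays the role of
    the range of the Riesz projection for the remaining part of the spectrum. *)
Definition near_space : set H := [set x | forall n, (N <= n)%N -> '[x, g n] = 0].

Definition low_coord x : 'rV[R[i]]_N := \row_i '[x, u i].

Lemma near_space_linear (a : R[i]) x y :
  near_space x -> near_space y -> near_space (a *: x + y).
Proof. by move=> hx hy n Nn; rewrite ipDl ipZl hx// hy// mulr0 addr0. Qed.

Lemma low_coord_linear (a : R[i]) x y :
  low_coord (a *: x + y) = a *: low_coord x + low_coord y.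
Proof. by apply/rowP => i; rewrite !mxE ipDl ipZl. Qed.

Let defect x k : R[i] := if (k < N)%N then 0 else '[x, g k - u k].

Let defect_bound x n : \sum_(0 <= i < n) nrm (defect x i) ^+ 2 <= (1 / 2 * nrm x) ^+ 2.
Proof.
have [nN|Nn] := leqP n N.
  rewrite big_nat big1 ?sqr_ge0// => i /andP[_ i_n].
  by rewrite /defect (leq_trans i_n nN) nrm0 expr0n.
rewrite (big_cat_nat (n := N)) ?(ltnW Nn)//= [X in X + _]big_nat big1 ?add0r; last first.
  by move=> i /andP[_ iN]; rewrite /defect iN nrm0 expr0n.
apply: le_trans (_ : \sum_(N <= i < n) nrm x ^+ 2 * nrm (g i - u i) ^+ 2 <= _).
  rewrite big_nat_cond [leRHS]big_nat_cond; apply: ler_sum => i; rewrite andbT => /andP[Ni _].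
  rewrite /defect ltnNge Ni /= -exprMn.
  by rewrite ler_sqr ?nnegrE ?mulr_ge0 ?nrm_ge0// (cauchy_schwarz norm_ip).
rewrite -mulr_sumr; have := ler_wpM2l (sqr_ge0 (nrm x)) (g_near n).
rewrite exprMn; lra.
Qed.

Let nrm_of_defect x y : (forall k, '[y, u k] = defect x k) -> nrm y <= 1 / 2 * nrm x.
Proof.
move=> hy; apply: (nrm_le_coord norm_ip u_ortho u_complete).
  by rewrite mulr_ge0 ?nrm_ge0.
by move=> n; apply: le_trans (defect_bound x n); apply: ler_sum => i _; rewrite hy.
Qed.

(** The coordinates of [x] are 0 below N and <x, u_k - g_k> from N on, so
    |x| <= |x| / 2. *)
Lemma near_space_inj x : near_space x -> low_coord x = 0 -> x = 0.
Proof.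
move=> hx cx; apply: nrm_le0_eq0.
suff : nrm (- x) <= 1 / 2 * nrm x by rewrite nrmN; have := nrm_ge0 x; lra.
apply: nrm_of_defect => k; rewrite /defect ipNl; case: ltnP => kN.
  by have /rowP/(_ (Ordinal kN)) := cx; rewrite !mxE/= => ->; rewrite oppr0.
by rewrite ipBr hx// sub0r.
Qed.

(** Solves x + D x = sum_(i < N) c_i u_i by iteration, where [D x] has the
    coordinates <x, g_k - u_k> for k >= N and hence norm at most |x| / 2. *)
Lemma near_space_lift c : exists2 x, near_space x & low_coord x = c.
Proof.
have /choice[D hD] : forall x, exists y, forall k, '[y, u k] = defect x k.
  move=> x; have [y [hy _]] := riesz_fischer norm_ip u_ortho (defect_bound x).
  by exists y.
pose cn k : R[i] := if insub k is Some i then c 0 i else 0.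
pose p := \sum_(0 <= i < N) cn i *: u i.
have [x _ xE] : exists2 x, setT x & p - D x = x.
  have h0 : 0 <= 1 / 2 :> R by lra.
  have h1 : 1 / 2 < 1 :> R by lra.
  apply: (@contraction_fixpoint _ _ setT (fun x => p - D x) _ 0 h0 h1) => //.
  - move=> x y _ _; rewrite opprD addrACA subrr add0r -opprD nrmN.
    apply: nrm_of_defect => k; rewrite ipBl !hD /defect.
    by case: ifP => _; rewrite ?subrr// ipBl.
have xk k : '[x, u k] + defect x k = if (k < N)%N then cn k else 0.
  by rewrite -{1}xE ipBl hD subrK (coord_sum u_ortho).
exists x.
  by move=> n Nn; have := xk n; rewrite /defect ltnNge Nn /= ipBr addrC subrK.
apply/rowP => i; rewrite mxE; have := xk i.
by rewrite /defect ltn_ord addr0 /cn valK => ->.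
Qed.

Lemma near_space_matrix (F : H -> H) :
  (forall x, near_space x -> near_space (F x)) ->
  (forall (a : R[i]) x y, near_space x -> near_space y ->
     F (a *: x + y) = a *: F x + F y) ->
  exists M : 'M[R[i]]_N, forall x, near_space x -> low_coord (F x) = low_coord x *m M.
Proof.
move=> FW Fl; have /choice[E hE] : forall c, exists x, near_space x /\ low_coord x = c.
  by move=> c; have [x] := near_space_lift c; exists x.
have [|M hM] := row_linear_mx (f := fun c => low_coord (F (E c))).
  move=> a c c'; rewrite -low_coord_linear -Fl; [|exact: (hE _).1|exact: (hE _).1].
  congr (low_coord (F _)); apply/eqP; rewrite -subr_eq0; apply/eqP.
  have [h1 c1] := hE (a *: c + c'); have [h2 c2] := hE c; have [h3 c3] := hE c'.
  have h4 := near_space_linear a h2 h3.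
  apply: near_space_inj; rewrite -scaleN1r addrC; first exact: near_space_linear.
  by rewrite !low_coord_linear c1 c2 c3 scaleN1r addNr.
exists M => x hx; rewrite -hM; congr (low_coord (F _)).
have [h1 c1] := hE (low_coord x).
apply/eqP; rewrite -subr_eq0; apply/eqP; apply: near_space_inj; rewrite -scaleN1r addrC.
  exact: near_space_linear.
by rewrite low_coord_linear c1 scaleN1r addNr.
Qed.

(** On the finite dimensional space the resolvent is injective, hence onto: every
    element of the space lies in the range of the resolvent. *)
Lemma near_space_dom x : near_space x -> dom B x.
Proof.
have SW y : near_space y -> near_space (S y).
  move=> hy n Nn; have [dy ey] := S_resolvent y.
  have := hy n Nn; rewrite -[X in '[X, _] = _]ey ipBl ipZl g_adjoint// -mulrBl.
  by move/eqP; rewrite mulf_eq0 subr_eq0 (negPf (w_mu Nn)) => /eqP.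
have [P hP] := near_space_matrix SW (fun a x y _ _ => S_linear a x y).
have Pfree : row_free P.
  rewrite -kermx_eq0; apply/rowV0P => c /sub_kermxP cP.
  have [y hy yc] := near_space_lift c.
  have Sy0 : S y = 0 by apply: near_space_inj; rewrite ?hP ?yc//; exact: SW.
  have [_ ey] := S_resolvent y.
  by rewrite -yc -ey Sy0 op0 scaler0 subr0; apply/rowP => i; rewrite !mxE ip0l.
move=> hx; have [y hy yc] := near_space_lift (low_coord x *m invmx P).
suff -> : x = S y by have [] := S_resolvent y.
apply/eqP; rewrite -subr_eq0; apply/eqP; apply: near_space_inj; rewrite -scaleN1r addrC.
  by apply: near_space_linear => //; exact: SW.
by rewrite low_coord_linear hP// yc mulmxKV -?row_free_unit// scaleN1r addNr.
Qed.

Lemma near_space_stable x : near_space x -> near_space (B x).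
Proof.
move=> hx n Nn; rewrite g_adjoint//; last exact: near_space_dom.
by rewrite hx// mulr0.
Qed.

Lemma root_space_ortho z x n : root_space B z x -> (N <= n)%N -> mu n != z ->
  '[x, g n] = 0.
Proof.
move=> [k _ [dx ex]] Nn muz.
have h : '[oppow (opshift B z) k x, g n] = (mu n - z) ^+ k * '[x, g n].
  elim: k dx {ex} => [|k IH]; first by rewrite expr0 mul1r.
  move=> /= [dk dkx]; rewrite ipBl ipZl g_adjoint// -mulrBl IH//.
  by rewrite exprS mulrA.
move: h; rewrite ex ip0l => /esym/eqP.
by rewrite mulf_eq0 expf_eq0 subr_eq0 (negPf muz) andbF => /eqP.
Qed.

(** A root vector at z is orthogonal to [g n] unless [mu n = z]. Hence the root
    space at z lies in the near space, or, if [z = mu n], is spanned by [f n] and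
    its part in the near space. *)
Lemma alg_mult_count : exists2 s : seq R[i], size s = N &
  forall z, (forall n, (N <= n)%N -> mu n != z) /\ alg_mult B z (count_mem z s) \/
    exists n, [/\ (N <= n)%N, mu n = z & alg_mult B z (count_mem z s).+1].
Proof.
have [|M hM] := near_space_matrix near_space_stable.
  by move=> a x y hx hy; rewrite op_linear//; exact: near_space_dom.
have pow x z k : near_space x -> [/\ dom (oppow (opshift B z) k) x,
    near_space (oppow (opshift B z) k x) &
    low_coord (oppow (opshift B z) k x) = low_coord x *m (M - z%:M) ^+ k].
  move=> hx; elim: k => [|k [d1 h1 e1]]; first by split => //=; rewrite expr0 mulmx1.
  split => /=; first by split => //; exact: near_space_dom.
    rewrite -scaleNr addrC; apply: near_space_linear => //; exact: near_space_stable.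
  rewrite -scaleNr addrC low_coord_linear hM// e1 exprSr -mulmxE mulmxA.
  by rewrite mulmxBr mul_mx_scalar scaleNr addrC.
have [s ss hs] := rank_geigenspaces M.
have /choice[E hE] : forall c, exists x, near_space x /\ low_coord x = c.
  by move=> c; have [x] := near_space_lift c; exists x.
have Eeq x : near_space x -> E (low_coord x) = x.
  move=> hx; have [h1 c1] := hE (low_coord x).
  apply/eqP; rewrite -subr_eq0; apply/eqP; apply: near_space_inj; rewrite -scaleN1r addrC.
    exact: near_space_linear.
  by rewrite low_coord_linear c1 scaleN1r addNr.
have El (a : R[i]) c c' : E (a *: c + c') = a *: E c + E c'.
  have [h2 c2] := hE c; have [h3 c3] := hE c'.
  by rewrite -[RHS]Eeq; [rewrite low_coord_linear c2 c3|exact: near_space_linear].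
have near z : has_dim [set x | root_space B z x /\ near_space x] (count_mem z s).
  rewrite -hs; apply: (has_dim_rowspace El).
    by move=> c Ec; rewrite -(hE c).2 Ec; apply/rowP => i; rewrite !mxE ip0l.
  move=> x; split=> [[[k _ [dx ex]] hx]|[c /sub_kermxP ck ->]].
    exists (low_coord x); last by rewrite Eeq.
    apply/sub_kermxP; apply: (@kermx_expr_stable _ _ _ _ k).
    have [_ _ <-] := pow x z k hx.
    by rewrite ex; apply/rowP => i; rewrite !mxE ip0l.
  have [h1 c1] := hE c; split => //; exists N => //.
  have [d2 h2 e2] := pow _ z N h1; split => //.
  by apply: near_space_inj => //; rewrite e2 c1.
exists s => // z.
have [[n [Nn nz]]|no] := pselect (exists n, (N <= n)%N /\ mu n = z).
  right; exists n; split => //.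
  have [df ef] := f_eigen Nn.
  have fz : root_space B z (f n).
    by apply: ker_root_space; split => //=; rewrite ef nz subrr.
  apply: (has_dim_add_line (v := f n) (near z)).
  - by move=> x [].
  - exact: fz.
  - move=> a [_ /(_ n Nn)]; rewrite ipZl => /eqP.
    by rewrite mulf_eq0 (negPf (fg_neq0 Nn)) orbF => /eqP.
  - move=> a x y [rx hx] [ry hy]; split; first exact: root_space_linear.
    exact: near_space_linear.
  - move=> x rx; exists ('[x, g n] / '[f n, g n]).
    rewrite -scaleNr addrC; split; first exact: root_space_linear.
    move=> m Nm; rewrite ipDl ipZl.
    have [->|mn] := eqVneq m n.
      by rewrite mulNr divfK ?addNr// fg_neq0.
    have muz : mu m != z.
      by apply: contraNneq mn => h; apply/eqP/mu_inj => //; rewrite h.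
    by rewrite !(root_space_ortho _ Nm muz)// mulr0 addr0.
left; have hz n : (N <= n)%N -> mu n != z.
  by move=> Nn; apply/eqP => h; apply: no; exists n.
split => //; rewrite /alg_mult.
suff <- : [set x | root_space B z x /\ near_space x] = root_space B z by exact: near.
apply/seteqP; split => x; first by case.
move=> rx; split => // n Nn; exact: (root_space_ortho rx Nn (hz _ Nn)).
Qed.

Lemma enumeration_with_mult : exists2 mu' : nat -> R[i],
  forall n, (N <= n)%N -> mu' n = mu n &
  forall z, exists2 m, alg_mult B z m & [set k | mu' k = z] #= `I_m.
Proof.
have [s ss hs] := alg_mult_count.
pose mu' k := if (k < N)%N then s`_k else mu k.
have mu'N n : (N <= n)%N -> mu' n = mu n by move=> Nn; rewrite /mu' ltnNge Nn.
exists mu' => // z; pose low := [seq k <- iota 0 N | mu' k == z].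
have size_low : size low = count_mem z s.
  rewrite size_filter -[in RHS](mkseq_nth 0 s) /mkseq count_map ss.
  by apply: eq_in_count => k; rewrite mem_iota /= add0n /mu' => ->.
have mem_low k : (k \in low) = (k < N)%N && (mu' k == z).
  by rewrite mem_filter mem_iota add0n andbC.
have uniq_low : uniq low by rewrite filter_uniq ?iota_uniq.
case: (hs z) => [[far am]|[n [Nn nz am]]].
  exists (count_mem z s) => //; rewrite -size_low.
  rewrite (_ : [set k | _] = [set k | k \in low]); first exact: card_uniq_seq.
  apply/seteqP; split => k /=; rewrite mem_low; last by move=> /andP[_ /eqP].
  move=> kz; rewrite kz eqxx andbT ltnNge; apply/negP => Nk.
  by have := far k Nk; rewrite -mu'N// kz eqxx.
have nlow : n \notin low by rewrite mem_low ltnNge Nn.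
exists (count_mem z s).+1 => //; rewrite -size_low.
rewrite (_ : [set k | _] = [set k | k \in n :: low]).
  by apply: (@card_uniq_seq _ (n :: low)); rewrite /= nlow.
apply/seteqP; split => k /=; rewrite inE mem_low.
  move=> kz; rewrite kz eqxx andbT; case: ltnP => [_|Nk]; first by rewrite orbT.
  by rewrite orbF; apply/eqP/mu_inj => //; rewrite nz -mu'N.
by case/orP => [/eqP ->|/andP[_ /eqP]//]; rewrite mu'N.
Qed.

End Counting.

(** * Rank-one perturbations of a diagonal operator *)

Section RankOnePerturbation.
Variables (R : realType) (H : completeNormedModType R[i]).
Variable ip : {dot H for Num.conj}.
Hypothesis norm_ip : norm_from_ip ip.
Local Notation "''[' x , y ]" := (ip x y).
Variable u : nat -> H.
Hypothesis u_ortho : forall i j, '[u i, u j] = (i == j)%:R.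
Hypothesis u_complete : forall x, (forall k, '[x, u k] = 0) -> x = 0.
Variables (l : nat -> R) (d : R).
Hypothesis d_gt0 : 0 < d.
Hypothesis l_sep : forall i j, i != j -> d <= `|l i - l j|.
Variable A : operator H.
Hypothesis A_coord : forall x k, dom A x -> '[A x, u k] = (l k)%:C * '[x, u k].
Hypothesis A_dom : forall x y, (forall k, '[y, u k] = (l k)%:C * '[x, u k]) ->
  dom A x /\ A x = y.
Implicit Types (x y phi psi : H) (z : R[i]).
Local Notation B := (rank_one_perturbation ip A).

Lemma perturbed_enumeration phi psi : exists2 mu : nat -> R[i],
  forall e : R, 0 < e -> exists N, forall n, (N <= n)%N -> nrm (mu n - (l n)%:C) <= e &
  forall z, exists2 m, alg_mult (B phi psi) z m & [set k | mu k = z] #= `I_m.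
Proof.
have [N0 [mu [f [g [near lim feig gadj [fg gsum]]]]]] :=
  perturbed_pairs norm_ip u_ortho u_complete d_gt0 l_sep A_coord A_dom phi psi.
have [w [S [wM Sl Sr]]] :=
  perturbed_resolvent norm_ip u_ortho u_complete A_dom phi psi d.
have NN n : (N0.+1 <= n)%N -> (N0 <= n)%N by exact: ltnW.
have [|||||||mu' mu'E hmu'] := @enumeration_with_mult _ _ _ norm_ip _ u_ortho u_complete
    (B phi psi) N0 mu f g _ _ _ _ _ w S Sl.
- by move=> n /NN/feig.
- by move=> n x /NN/gadj; exact.
- by move=> n /NN/fg.
- move=> m; apply: le_trans (gsum m); have [mN|Nm] := leqP m N0.+1.
    by rewrite big_geq// sumr_ge0// => i _; exact: sqr_ge0.
  by rewrite [leRHS]big_ltn ?(ltn_trans _ Nm)// lerDr sqr_ge0.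
- move=> m n /NN Nm /NN Nn e; apply/eqP; rewrite -[_ == _]negbK; apply/negP => mn.
  have := l_sep mn; have := near m Nm; have := near n Nn.
  have := nrm_dist (mu m) (l m)%:C (l n)%:C; rewrite -rmorphB nrmR e nrmBC.
  move: d_gt0; lra.
- exact: Sr.
- move=> n /NN/near h; apply/eqP => e; move: wM; rewrite -e ltNge => /negP; apply.
  have := Im_le_nrm (mu n - (l n)%:C).
  have -> : complex.Im (mu n - (l n)%:C) = complex.Im (mu n).
    by case: (mu n) => a b /=; rewrite subr0.
  have := ler_norm (complex.Im (mu n)); move: d_gt0; lra.
exists mu' => // e /lim[N hN]; exists (maxn N N0.+1) => n.
by rewrite geq_max => /andP[n1 n2]; rewrite mu'E//; exact: hN.
Qed.

Lemma A_basis k : dom A (u k) /\ A (u k) = (l k)%:C *: u k.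
Proof. by apply: A_dom => j; rewrite ipZl u_ortho; case: eqVneq => [->//|_]; rewrite !mulr0. Qed.

Lemma l_inj j k : (l j)%:C = (l k)%:C :> R[i] -> j = k.
Proof.
move=> /complexI e; apply/eqP; rewrite -[_ == _]negbK; apply/negP => /l_sep.
by rewrite e subrr normr0 leNgt d_gt0.
Qed.

Lemma A_eigenvector z x : dom A x -> A x = z *: x -> x != 0 ->
  exists2 k, z = (l k)%:C & x = '[x, u k] *: u k.
Proof.
move=> Ax ex x0.
have h k : ((l k)%:C - z) * '[x, u k] = 0 by rewrite mulrBl -A_coord// ex ipZl subrr.
have [k xk] : exists k, '[x, u k] != 0.
  apply: contrapT => no; move/eqP: x0; apply; apply: u_complete => k.
  by apply/eqP; rewrite -[_ == _]negbK; apply/negP => xk; apply: no; exists k.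
have zk : z = (l k)%:C.
  by have /eqP := h k; rewrite mulf_eq0 (negPf xk) orbF subr_eq0 => /eqP.
exists k => //; apply: (coord_ext u_complete) => j; rewrite ipZl u_ortho.
case: eqVneq => [->|kj]; first by rewrite mulr1.
rewrite mulr0; have /eqP := h j; rewrite mulf_eq0 zk subr_eq0 => /orP[/eqP/l_inj e|/eqP//].
by rewrite e eqxx in kj.
Qed.

Lemma ker_A_shift k x : ker (opshift A (l k)%:C) x <-> exists a : R[i], x = a *: u k.
Proof.
split=> [[/= Ax /eqP]|[a ->]].
  rewrite subr_eq0 => /eqP ex; have [->|x0] := eqVneq x 0; first by exists 0; rewrite scale0r.
  by have [j /l_inj <- ->] := A_eigenvector Ax ex x0; exists '[x, u k].
have [Au eu] := A_basis k; rewrite -[_ *: _]addr0; split => /=.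
  by apply: domP => //; exact: dom0.
by rewrite op_linear ?op0//; [rewrite !addr0 eu !scalerA mulrC subrr|exact: dom0].
Qed.

Section Multiplicity.
Variables (phi psi : H) (z : R[i]).
Let W := ker (opshift (B phi psi) z).
Let W0 := [set x | W x /\ '[x, phi] = 0].

Let W0_A x : W0 x -> dom A x /\ A x = z *: x.
Proof.
by move=> [[/= Ax ex] h0]; split => //; apply/eqP; rewrite -subr_eq0 -ex h0 scale0r addr0.
Qed.

Let W_linear (a : R[i]) x y : W x -> W y -> W (a *: x + y).
Proof. exact: ker_linear. Qed.

Let W0_linear (a : R[i]) x y : W0 x -> W0 y -> W0 (a *: x + y).
Proof.
move=> [Wx x0] [Wy y0]; split; first exact: W_linear.
by rewrite ipDl ipZl x0 y0 mulr0 addr0.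
Qed.

(** [W0] lies in the kernel of A - z, which is zero or the line of a basis vector. *)
Let W0_dim : has_dim W0 0 \/ has_dim W0 1 /\ exists2 k, z = (l k)%:C & '[u k, phi] = 0.
Proof.
have [[e [W0e e0]]|no] := pselect (exists e, W0 e /\ e != 0); last first.
  left; apply: has_dim0 => x W0x; apply/eqP; rewrite -[_ == _]negbK; apply/negP => x0.
  by apply: no; exists x.
right; have [Ae ee] := W0_A W0e; have [k zk ek] := A_eigenvector Ae ee e0.
have ek0 : '[e, u k] != 0 by apply: contraNneq e0 => h; rewrite ek h scale0r.
split; last first.
  exists k => //; case: W0e => _; rewrite ek ipZl => /eqP.
  by rewrite mulf_eq0 (negPf ek0) => /eqP.
apply: (has_dim1 W0e e0) => x W0x.
have [->|x0] := eqVneq x 0; first by exists 0; rewrite scale0r.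
have [Ax ex] := W0_A W0x; have [j zj ej] := A_eigenvector Ax ex x0.
have jk : j = k by apply: l_inj; rewrite -zj zk.
exists ('[x, u k] / '[e, u k]); rewrite {2}ek scalerA divfK// {1}ej jk.
by [].
Qed.

Let W_W0 v : W v -> '[v, phi] != 0 -> forall n, has_dim W0 n -> has_dim W n.+1.
Proof.
move=> Wv v0 n h; apply: (has_dim_add_line (v := v) h _ Wv _ W0_linear).
- by move=> x [].
- by move=> a [_]; rewrite ipZl => /eqP; rewrite mulf_eq0 (negPf v0) orbF => /eqP.
- move=> x Wx; exists ('[x, phi] / '[v, phi]); rewrite -scaleNr addrC.
  split; first exact: W_linear.
  by rewrite ipDl ipZl mulNr divfK// addNr.
Qed.

Let W_eq_W0 : (forall v, W v -> '[v, phi] = 0) -> W = W0.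
Proof. by move=> h; apply/seteqP; split => x [] //; split => //; apply: h. Qed.

Lemma geo_mult_le2 : exists2 k, (k <= 2)%N & geo_mult (B phi psi) z k.
Proof.
rewrite /geo_mult -/W.
have [[v [Wv v0]]|no] := pselect (exists v, W v /\ '[v, phi] != 0).
  case: W0_dim => [|[]] h; first by exists 1%N => //; exact: (W_W0 Wv v0).
  by exists 2%N => //; exact: (W_W0 Wv v0).
rewrite W_eq_W0; last first.
  move=> v Wv; apply/eqP; rewrite -[_ == _]negbK; apply/negP => v0; apply: no.
  by exists v.
by case: W0_dim => [|[]] h; [exists 0%N|exists 1%N].
Qed.

(** Dimension two forces the functional <., phi> to be nonzero on the eigenspace
    and to vanish on one of its vectors, which is then an eigenvector [u k] of
    [A]; the solvability of (A - l_k) v = - <v, phi> psi gives <psi, u_k> = 0. *)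
Lemma geo_mult2_decouples : geo_mult (B phi psi) z 2 ->
  exists k, [/\ z = (l k)%:C, '[u k, phi] = 0 & '[psi, u k] = 0].
Proof.
rewrite /geo_mult -/W => h2.
have [[v [Wv v0]]|no] := pselect (exists v, W v /\ '[v, phi] != 0); last first.
  move: h2; rewrite W_eq_W0; last first.
    move=> v Wv; apply/eqP; rewrite -[_ == _]negbK; apply/negP => v0; apply: no.
    by exists v.
  by case: W0_dim => [h|[h _]] h2; have := has_dim_unique h h2.
case: W0_dim => [|[]] h; first by have := has_dim_unique (W_W0 Wv v0 h) h2.
move=> [k zk kphi]; exists k; split => //.
have [/= Av] := Wv; move/(congr1 (fun x => '[x, u k])).
rewrite ip0l ipBl ipDl !ipZl A_coord// zk addrAC subrr add0r => /eqP.
by rewrite mulf_eq0 (negPf v0) => /eqP.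
Qed.

End Multiplicity.

Lemma decoupled_reducing phi psi k : '[u k, phi] = 0 -> '[psi, u k] = 0 ->
  reducing ip (ker (opshift A (l k)%:C)) (B phi psi).
Proof.
move=> kphi kpsi; have [Au eu] := A_basis k; split.
- move=> x /closure_nrmP cx; apply/ker_A_shift; exists '[x, u k].
  apply: (coord_ext u_complete) => j; rewrite ipZl u_ortho.
  case: eqVneq => [->|kj]; first by rewrite mulr1.
  rewrite mulr0; apply: nrm_eps_eq0 => e /cx[y /ker_A_shift[a ->] h].
  apply/ltW; apply: le_lt_trans h.
  have := cauchy_schwarz norm_ip (x - a *: u k) (u j).
  by rewrite ipBl ipZl u_ortho (negPf kj) mulr0 subr0 (nrm_u norm_ip u_ortho) mulr1.
- move=> x /= Ax; exists ('[x, u k] *: u k), (x - '[x, u k] *: u k); split.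
  + by rewrite -[_ *: _]addr0; apply: domP => //; exact: dom0.
  + by apply/ker_A_shift; exists '[x, u k].
  + by rewrite -scaleNr addrC; exact: domP.
  + move=> y /ker_A_shift[a ->].
    by rewrite ipZr ipBl ipZl u_ortho eqxx mulr1 subrr mulr0.
  + by rewrite addrC subrK.
- move=> y _ /ker_A_shift[a ->] /=; apply/ker_A_shift; exists (a * (l k)%:C).
  rewrite -[X in A X]addr0 op_linear ?op0//; last exact: dom0.
  by rewrite addr0 ipZl kphi mulr0 scale0r addr0 eu scalerA.
- move=> x /= Ax xo y /ker_A_shift[a ->].
  have xk : '[x, u k] = 0 by apply: xo; apply/ker_A_shift; exists 1; rewrite scale1r.
  by rewrite ipZr ipDl ipZl A_coord// xk kpsi !mulr0 addr0 mulr0.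
Qed.

(** On the span of the first [L] basis vectors,
    [f |-> sum_k f(l_k) / w_k u_k], with w_k = prod_(j <> k) (l_k - l_j), identifies
    the polynomials of degree less than [L] with vectors; [A] becomes multiplication
    by 'X modulo prod_k ('X - l_k), and <., sum_k u_k> the coefficient of
    'X^(L - 1). For a monic [q] of degree [L], the perturbation by
    psi = - sum_k q(l_k) / w_k u_k turns this into multiplication modulo [q]. *)
Section PrescribedSpectrum.
Variables (L' : nat) (s : seq R[i]).
Local Notation L := L'.+1.
Hypothesis s_size : size s = L.
Implicit Types f g : {poly R[i]}.

Let q : {poly R[i]} := \prod_(x <- s) ('X - x%:P).
Let node (k : nat) : R[i] := (l k)%:C.
Let cofactor_poly k : {poly R[i]} := \prod_(j <- iota 0 L | j != k) ('X - (node j)%:P).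
Let weight k : R[i] := (cofactor_poly k).[node k].
Let interp (f : {poly R[i]}) : H := \sum_(0 <= k < L) (f.[node k] / weight k) *: u k.

Definition prescribed_phi : H := \sum_(0 <= k < L) (1 : R[i]) *: u k.
Definition prescribed_psi : H := \sum_(0 <= k < L) (- q.[node k] / weight k) *: u k.

Let q_monic : q \is monic. Proof. exact: monic_prod_XsubC. Qed.
Let q_size : size q = L.+1. Proof. by rewrite size_prod_XsubC s_size. Qed.
Let q_lead : q`_L = 1.
Proof. by have /monicP := q_monic; rewrite lead_coefE q_size. Qed.

Let weight_neq0 k : (k < L)%N -> weight k != 0.
Proof.
move=> kL; rewrite /weight horner_prod prodf_seq_neq0; apply/allP => j _.
apply/implyP => jk; rewrite hornerXsubC subr_eq0.
by apply: contraNneq jk => /l_inj ->.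
Qed.

Let cofactor_root k i : (i < L)%N -> i != k -> (cofactor_poly k).[node i] = 0.
Proof.
move=> iL ik; apply/eqP; rewrite horner_prod prodf_seq_eq0; apply/hasP.
by exists i; rewrite ?mem_iota// ik hornerXsubC subrr eqxx.
Qed.

Let size_cofactor k : (k < L)%N -> size (cofactor_poly k) = L.
Proof.
move=> kL; rewrite /cofactor_poly -big_filter size_prod_XsubC size_filter.
have := count_predC (pred1 k) (iota 0 L); rewrite size_iota count_uniq_mem ?iota_uniq//.
have -> : k \in iota 0 L by rewrite mem_iota.
by rewrite add1n.
Qed.

Let cofactor_lead k : (k < L)%N -> (cofactor_poly k)`_L' = 1.
Proof.
move=> kL; have /monicP : cofactor_poly k \is monic by exact: monic_prod_XsubC.
by rewrite lead_coefE size_cofactor.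
Qed.

Let poly_ext (f g : {poly R[i]}) : (size f <= L)%N -> (size g <= L)%N ->
  (forall k, (k < L)%N -> f.[node k] = g.[node k]) -> f = g.
Proof.
move=> fL gL fg; apply/eqP; rewrite -subr_eq0; apply/eqP.
apply: (roots_geq_poly_eq0 (rs := [seq node k | k <- iota 0 L])).
- apply/allP => x /mapP[k]; rewrite mem_iota add0n => /andP[_ kL] ->.
  by rewrite rootE hornerD hornerN fg// subrr.
- by rewrite map_inj_uniq ?iota_uniq// => i j; exact: l_inj.
- rewrite size_map size_iota; apply: leq_trans (size_polyD _ _) _.
  by rewrite size_polyN geq_max fL.
Qed.

Let lagrange (c : nat -> R[i]) : let f := \sum_(0 <= k < L) c k *: cofactor_poly k in
  [/\ (size f <= L)%N, forall k, (k < L)%N -> f.[node k] = c k * weight k &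
      f`_L' = \sum_(0 <= k < L) c k].
Proof.
split.
- rewrite big_mkord; apply: leq_trans (size_sum _ _ _) _.
  by apply/bigmax_leqP => k _; apply: leq_trans (size_scale_leq _ _) _; rewrite size_cofactor.
- move=> k kL; rewrite horner_sum (bigD1_seq k) ?iota_uniq ?mem_index_iota//=.
  rewrite hornerZ big_seq_cond big1 ?addr0// => j /andP[]; rewrite mem_index_iota => /andP[_ jL] jk.
  by rewrite hornerZ cofactor_root ?mulr0// eq_sym.
- rewrite coef_sum; apply: eq_big_nat => k /andP[_ kL].
  by rewrite coefZ cofactor_lead// mulr1.
Qed.

Let coord_interp f k : '[interp f, u k] = if (k < L)%N then f.[node k] / weight k else 0.
Proof. by rewrite (coord_sum u_ortho) leq0n. Qed.

Let interp_linear (a : R[i]) f g : interp (a *: f + g) = a *: interp f + interp g.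
Proof.
apply: (coord_ext u_complete) => k; rewrite ipDl ipZl !coord_interp.
by case: ifP => _; rewrite ?mulr0 ?addr0// hornerD hornerZ mulrDl mulrA.
Qed.

Let interp_inj f : (size f <= L)%N -> interp f = 0 -> f = 0.
Proof.
move=> fL f0; apply: poly_ext => //; first by rewrite size_poly0.
move=> k kL; have := coord_interp f k; rewrite f0 ip0l kL horner0 => /esym/eqP.
by rewrite mulf_eq0 invr_eq0 (negPf (weight_neq0 kL)) orbF => /eqP.
Qed.

Let interp_onto x : (forall k, (L <= k)%N -> '[x, u k] = 0) ->
  exists2 f : {poly R[i]}, (size f <= L)%N & x = interp f.
Proof.
move=> x0; have [fL fk _] := lagrange (fun k => '[x, u k]).
exists (\sum_(0 <= k < L) '[x, u k] *: cofactor_poly k) => //.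
apply: (coord_ext u_complete) => k; rewrite coord_interp.
by case: ltnP => [kL|/x0//]; rewrite fk// mulfK// weight_neq0.
Qed.

Let interp_phi f : (size f <= L)%N -> '[interp f, prescribed_phi] = f`_L'.
Proof.
move=> fL; have [gL gk gt] := lagrange (fun k => f.[node k] / weight k).
have -> : f = \sum_(0 <= k < L) (f.[node k] / weight k) *: cofactor_poly k.
  by apply: poly_ext => // k kL; rewrite gk// divfK// weight_neq0.
rewrite gt ip_sumr; apply: eq_big_nat => k /andP[_ kL].
by rewrite ipZr rmorph1 mul1r coord_interp kL gk// mulfK// weight_neq0.
Qed.

Local Notation Bq := (B prescribed_phi prescribed_psi).

(** (X - z) f modulo q, for f of degree less than L. *)
Let step z f := ('X - z%:P) * f - f`_L' *: q.

Let step_size z f : (size f <= L)%N -> (size (step z f) <= L)%N.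
Proof.
move=> fL; apply/leq_sizeP => j Lj.
rewrite /step mulrBl mul_polyC !coefB coefXM !coefZ.
case: j Lj => [//|j]; rewrite ltnS /= => Lj.
rewrite (nth_default 0 (leq_trans fL (Lj : (L <= j.+1)%N))) mulr0 subr0.
move: Lj; rewrite leq_eqVlt => /orP[/eqP <-|Lj]; first by rewrite q_lead mulr1 subrr.
by rewrite (nth_default 0 (leq_trans fL Lj)) [q`__]nth_default ?q_size// mulr0 subrr.
Qed.

Let B_interp z f : (size f <= L)%N ->
  dom Bq (interp f) /\ opshift Bq z (interp f) = interp (step z f).
Proof.
move=> fL.
have [Af Afe] : dom A (interp f) /\ A (interp f) =
    \sum_(0 <= k < L) (node k * (f.[node k] / weight k)) *: u k.
  apply: A_dom => k; rewrite (coord_sum u_ortho) leq0n coord_interp.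
  by rewrite /=; case: ifP => // _; rewrite mulr0.
split => //=; rewrite Afe interp_phi//.
apply: (coord_ext u_complete) => k; rewrite ipBl ipDl !ipZl !coord_interp.
rewrite !(coord_sum u_ortho) leq0n /=; case: ltnP => kL; last first.
  by rewrite !mulr0 addr0 subrr.
rewrite /step hornerD hornerN hornerM hornerXsubC hornerZ; field; exact: weight_neq0.
Qed.

Let oppow_interp z f k : (size f <= L)%N -> [/\ dom (oppow (opshift Bq z) k) (interp f),
  oppow (opshift Bq z) k (interp f) = interp (iter k (step z) f) &
  (size (iter k (step z) f) <= L)%N].
Proof.
move=> fL; elim: k => [//|k [dk ek sk]].
have [d1 e1] := B_interp z sk.
split; last exact: step_size.
  by split => //; rewrite ek.
by rewrite -[LHS]/(opshift Bq z (oppow (opshift Bq z) k (interp f))) ek e1.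
Qed.

Let iter_step z f k : exists g, iter k (step z) f = ('X - z%:P) ^+ k * f - g * q.
Proof.
elim: k => [|k [g /= ->]]; first by exists 0; rewrite expr0 mul1r mul0r subr0.
set h := _ - g * q; exists (('X - z%:P) * g + (h`_L')%:P).
rewrite /step -mul_polyC /h exprS; ring.
Qed.

(** Write q = (X - z)^m r with r(z) <> 0. Polynomials f with q dividing
    (X - z)^k f for some k are the multiples of r; those of degree less than L
    are r g with g of degree less than m. Coordinates of index k >= L vanish on a
    root vector at z, as the operator acts on them by the scalar l_k <> z. *)
Lemma prescribed_alg_mult z : z \in s -> (forall k, (L <= k)%N -> (l k)%:C != z) ->
  alg_mult Bq z (count_mem z s).
Proof.
move=> zs far; set m := count_mem z s.
have m0 : (0 < m)%N by rewrite -has_count has_pred1.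
pose r : {poly R[i]} := \prod_(x <- s | x != z) ('X - x%:P).
have qE : q = ('X - z%:P) ^+ m * r.
  rewrite /q (bigID (pred1 z))/=; congr (_ * _).
  rewrite (eq_bigr (fun=> 'X - z%:P)) => [|x /eqP ->//].
  by rewrite big_const_seq iter_mulr mulr1.
have r_monic : r \is monic by exact: monic_prod_XsubC.
have r0 : r != 0 by exact: monic_neq0.
have rz : ~~ root r z.
  rewrite /root horner_prod prodf_seq_neq0; apply/allP => x _; apply/implyP => xz.
  by rewrite hornerXsubC subr_eq0 eq_sym.
have rs : (size r + m)%N = L.+1.
  rewrite -q_size qE size_monicM ?monic_exp ?monicXsubC// size_exp_XsubC.
  by rewrite addSn addnC.
pose E (c : 'rV[R[i]]_m) := interp (r * rVpoly c).
have Esize (c : 'rV[R[i]]_m) : (size (r * rVpoly c)%R <= L)%N.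
  apply: leq_trans (size_polyMleq _ _) _; rewrite -ltnS -rs prednK.
    by rewrite leq_add2l size_poly.
  by rewrite ltn_addr// size_poly_gt0.
rewrite -(mxrank1 R[i] m); apply: (has_dim_rowspace (E := E)).
- by move=> a c c'; rewrite /E linearP/= mulrDr -scalerAr interp_linear.
- move=> c /(interp_inj (Esize c))/eqP; rewrite mulf_eq0 (negPf r0) /= => /eqP h.
  by rewrite -[c]rVpolyK h linear0.
move=> x; split => [[k _ [dx ex]]|[c _ ->]].
  have [i iL|f fL xf] := @interp_onto x.
    have h : '[oppow (opshift Bq z) k x, u i] = ((l i)%:C - z) ^+ k * '[x, u i].
      elim: k dx {ex} => [|k IH]; first by rewrite expr0 mul1r.
      move=> /= [dk dkx]; rewrite ipBl ipDl !ipZl A_coord// (coord_sum u_ortho).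
      by rewrite ltnNge iL andbF mulr0 addr0 -mulrBl IH// exprS mulrA.
    move: h; rewrite ex ip0l => /esym/eqP.
    by rewrite mulf_eq0 expf_eq0 subr_eq0 (negPf (far i iL)) andbF => /eqP.
  have [_ e1 s1] := oppow_interp z k fL; have [g e2] := iter_step z f k.
  have : r %| f.
    rewrite -(@Gauss_dvdpr _ _ (('X - z%:P) ^+ k)); last first.
      by rewrite coprimep_expr// coprimep_XsubC.
    move: ex; rewrite xf e1 => /(interp_inj s1); rewrite e2 => /eqP.
    by rewrite subr_eq0 => /eqP ->; rewrite qE !dvdp_mull.
  move/divpK => fE; exists (poly_rV (f %/ r)); first exact: submx1.
  rewrite /E poly_rV_K ?[r * _]mulrC ?fE//.
  rewrite size_divp// leq_subLR; apply: leq_trans fL _.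
  by rewrite -ltnS -rs -addSn prednK ?size_poly_gt0.
exists m => //; have [d1 e1 s1] := oppow_interp z m (Esize c); split => //.
have [g e2] := iter_step z (r * rVpoly c) m.
rewrite e1; suff -> : iter m (step z) (r * rVpoly c) = 0.
  apply: (coord_ext u_complete) => i.
  by rewrite coord_interp horner0 mul0r ip0l if_same.
have e3 : iter m (step z) (r * rVpoly c) = (rVpoly c - g) * q.
  by rewrite e2 mulrA -qE mulrBl [q * _]mulrC.
apply/eqP; rewrite -[_ == _]negbK; apply/negP => n0.
have := s1; rewrite e3 size_Mmonic//; last first.
  by apply: contraNneq n0 => h; rewrite e3 h mul0r.
rewrite q_size addnS /= -ltnS; apply/negP; rewrite -leqNgt.
rewrite -[leqLHS]add1n leq_add2r size_poly_gt0.
by apply: contraNneq n0 => h; rewrite e3 h mul0r.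
Qed.

Lemma prescribed_phi_neq0 : prescribed_phi != 0.
Proof.
apply: contraTneq (oner_neq0 R[i]) => h; rewrite negbK.
by have := coord_sum u_ortho (fun=> 1) 0 L 0; rewrite -/prescribed_phi h ip0l /= => <-.
Qed.

(** Otherwise q, of degree L, would vanish at w and at L other points. *)
Lemma prescribed_psi_neq0 w : w \in s -> (forall k, (l k)%:C != w) -> prescribed_psi != 0.
Proof.
move=> ws wl; apply/eqP => h.
have qk k : (k < L)%N -> q.[node k] = 0.
  move=> kL; have := coord_sum u_ortho (fun k => - q.[node k] / weight k) 0 L k.
  rewrite -/prescribed_psi h ip0l kL /= => /esym/eqP.
  by rewrite mulf_eq0 invr_eq0 (negPf (weight_neq0 kL)) orbF oppr_eq0 => /eqP.
have : (size (w :: [seq node k | k <- iota 0 L]) < size q)%N.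
  apply: max_poly_roots; first exact: monic_neq0.
    apply/allP => x; rewrite in_cons => /orP[/eqP ->|/mapP[k]].
      by rewrite root_prod_XsubC.
    rewrite mem_iota add0n => /andP[_ kL] ->.
    by rewrite rootE qk.
  rewrite cons_uniq map_inj_uniq ?iota_uniq ?andbT; last by move=> i j; exact: l_inj.
  by apply/mapP => -[k _ wk]; have := wl k; rewrite wk eqxx.
by rewrite /= size_map size_iota q_size ltnn.
Qed.

End PrescribedSpectrum.

(** [L] must be so large that the block contains every [l k] equal to some z_j:
    outside the block [l k] remains an eigenvalue of the perturbation and would
    raise the multiplicity. *)
Lemma prescribed_spectrum n (z : 'I_n -> R[i]) (m : 'I_n -> nat) :
  injective z -> (forall j, (0 < m j)%N) ->
  exists phi psi, [/\ phi != 0, psi != 0 & forall j, alg_mult (B phi psi) (z j) (m j)].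
Proof.
move=> z_inj m0; pose M : R := \sum_j nrm (z j).
have zM j : nrm (z j) <= M.
  by rewrite /M (bigD1 j)//= lerDl sumr_ge0// => i _; exact: nrm_ge0.
have [N hN] := separated_unbounded d_gt0 l_sep M.
(* fills up the degree; being non-real, it forces [psi] to be nonzero *)
pose w : R[i] := (M + 1) *i.
have M0 : 0 <= M by apply: sumr_ge0 => j _; exact: nrm_ge0.
have wM : M < nrm w.
  by apply: lt_le_trans (Im_le_nrm w); rewrite /= ger0_norm; lra.
pose s1 := flatten [seq nseq (m j) (z j) | j <- enum 'I_n].
pose s := nseq N.+1 w ++ s1.
have ss : size s = (N + size s1).+1 by rewrite size_cat size_nseq addSn.
have cs j : count_mem (z j) s = m j.
  have zw : z j != w by apply/eqP => e; move: wM; rewrite -e ltNge zM.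
  rewrite count_cat count_nseq /= eq_sym (negPf zw) mul0n add0n.
  rewrite count_flatten -map_comp sumnE big_map big_enum /= (bigD1 j)//=.
  rewrite count_nseq /= eqxx mul1n big1 ?addn0// => i ij.
  by rewrite count_nseq /= (inj_eq z_inj) (negPf ij) mul0n.
have far j k : (N <= k)%N -> (l k)%:C != z j.
  move=> Nk; apply/eqP => e; have := zM j; rewrite -e nrmR.
  by have := hN k Nk; lra.
exists (prescribed_phi (N + size s1)), (prescribed_psi (N + size s1) s); split.
- exact: prescribed_phi_neq0.
- apply: (prescribed_psi_neq0 ss (w := w)); first by rewrite mem_cat mem_nseq eqxx.
  by move=> k; apply/eqP => -[_ e]; move: M0; lra.
- move=> j; rewrite -(cs j); apply: prescribed_alg_mult => //.
    by rewrite -has_pred1 has_count cs m0.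
  by move=> k Nk; apply: far; apply: leq_trans Nk; rewrite ltnW// ltnS leq_addr.
Qed.

End RankOnePerturbation.

Section RootSpaceEigenvalue.
Variables (K : fieldType) (V : lmodType K).

Lemma root_space_eigenvalue (T : operator V) z x :
  root_space T z x -> x != 0 -> is_eigenvalue T z.
Proof.
move=> [k _]; elim: k => [[_ /= ->]|k IH [[dx dy] ey] x0]; first by rewrite eqxx.
have [y0|y0] := eqVneq (oppow (opshift T z) k x) 0; first exact: IH.
by exists (oppow (opshift T z) k x).
Qed.

Lemma alg_mult_eigenvalue (T : operator V) z m : (0 < m)%N -> alg_mult T z m ->
  is_eigenvalue T z.
Proof.
case: m => // m _ [e [eW ei _]]; apply: (root_space_eigenvalue (eW ord0)).
apply/eqP => e0; have := ei (fun i => (i == ord0)%:R).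
rewrite (bigD1 ord0)//= big1 => [|i /negPf ->]; last by rewrite scale0r.
rewrite e0 scaler0 addr0 => /(_ erefl ord0)/eqP.
by rewrite oner_eq0.
Qed.

Lemma eigenvalue_alg_mult (T : operator V) z m : is_eigenvalue T z -> alg_mult T z m ->
  (0 < m)%N.
Proof.
move=> [x x0 kx]; case: m => // /has_dim0P h; move: x0.
by rewrite (h x (ker_root_space kx)) eqxx.
Qed.

End RootSpaceEigenvalue.

(** * The eigenbasis of the self-adjoint operator *)

Section Spectrum.
Variables (R : realType) (H : completeNormedModType R[i]).
Variable ip : {dot H for Num.conj}.
Hypothesis norm_ip : norm_from_ip ip.
Local Notation "''[' x , y ]" := (ip x y).
Variable A : operator H.
Hypothesis A_self_adjoint : self_adjoint ip A.
Hypothesis A_spectrum : simple_discrete_spectrum A.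
Implicit Types (x y : H) (z : R[i]).

Lemma self_adjoint_sym x y : dom A x -> dom A y -> '[A x, y] = '[x, A y].
Proof.
move=> Ax Ay; have [_ e] := A_self_adjoint.
have : adjoint_graph ip A (y, A y) by rewrite e.
by move=> /(_ x Ax).
Qed.

Lemma eigenvalue_not_resolvent z : is_eigenvalue A z -> ~ resolvent_set A z.
Proof.
move=> [x x0 [dx ex]] [S [_ _ hS]]; move: x0.
by rewrite -(hS x dx) ex linear0 eqxx.
Qed.

Lemma eigenvector_unique z x y : ker (opshift A z) x -> x != 0 ->
  ker (opshift A z) y -> exists a : R[i], y = a *: x.
Proof.
move=> kx x0 ky.
have [|_ /has_dim1P[v [_ _ hv]]] := A_spectrum (z := z).
  by apply: eigenvalue_not_resolvent; exists x.
have [a xa] := hv x (ker_root_space kx); have [b yb] := hv y (ker_root_space ky).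
have a0 : a != 0 by apply: contraNneq x0 => a0; rewrite xa a0 scale0r.
by exists (b / a); rewrite yb xa scalerA divfK.
Qed.

Lemma spectrum_isolated (lambda : R) : ~ resolvent_set A lambda%:C ->
  exists2 rho : R, 0 < rho &
    forall t : R, t != lambda -> `|t - lambda| < rho -> resolvent_set A t%:C.
Proof.
move=> /A_spectrum[[_ [V /nbhs_ballP[e /= e0 eV] VE]] _].
have eE : e = (complex.Re e)%:C by rewrite RRe_real// gtr0_real.
exists (complex.Re e); first by rewrite -ltcR -eE.
move=> t tl te; apply: contrapT => nt.
have : [set lambda%:C] t%:C.
  rewrite -VE; split => //; apply: eV; rewrite -ball_normE /ball_/=.
  by rewrite distrC -rmorphB eE nrm_ltC nrmR.
by move=> /= /complexI e'; rewrite e' eqxx in tl.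
Qed.

Variables (l : nat -> R).
Hypothesis l_inj : injective l.
Hypothesis l_eigen : [set z | is_eigenvalue A z] = [set (l k)%:C | k in setT].

Lemma orthonormal_eigenvectors : exists u : nat -> H,
  [/\ forall i j, '[u i, u j] = (i == j)%:R,
      forall k, dom A (u k) /\ A (u k) = (l k)%:C *: u k &
      forall x z, dom A x -> A x = z *: x -> x != 0 ->
        exists k, exists a : R[i], x = a *: u k].
Proof.
have /choice[v hv] : forall k, exists v, nrm v = 1 /\ ker (opshift A (l k)%:C) v.
  move=> k; have [x x0 kx] : is_eigenvalue A (l k)%:C.
    by have : [set z | is_eigenvalue A z] (l k)%:C by rewrite l_eigen; exists k.
  exists ((nrm x)^-1%:C *: x); split.
    by rewrite nrmZ nrmR ger0_norm ?invr_ge0 ?nrm_ge0// mulVf// nrm_eq0.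
  by rewrite -[_ *: x]addr0; apply: ker_linear => //; split => /=;
    [exact: dom0|rewrite op0 scaler0 subrr].
have veig k : dom A (v k) /\ A (v k) = (l k)%:C *: v k.
  have [_ [dv /eqP]] := hv k; rewrite /= subr_eq0 => /eqP; by [].
exists v; split => //.
- move=> i j; case: eqVneq => [->|ij].
    by rewrite (ip_nrm norm_ip) (hv j).1 expr1n.
  have [di ei] := veig i; have [dj ej] := veig j.
  have := self_adjoint_sym di dj; rewrite ei ej ipZl ipZr conj_realC => /eqP.
  rewrite -subr_eq0 -mulrBl mulf_eq0 subr_eq0 => /orP[/eqP/complexI/l_inj e|/eqP//].
  by rewrite e eqxx in ij.
- move=> x z dx ex x0.
  have kx : ker (opshift A z) x by split => //=; rewrite ex subrr.
  have : [set z | is_eigenvalue A z] z by exists x.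
  rewrite l_eigen => -[k _ zk]; exists k; rewrite -zk in kx.
  apply: (eigenvector_unique (hv k).2) => //.
  by rewrite -nrm_gt0 (hv k).1.
Qed.

(** The last clause, maximality of the diagonal operator, comes from a real point
    m of the resolvent set: the resolvent at m maps y - m x to a vector with the
    coordinates of x. *)
Lemma eigenbasis : exists u : nat -> H,
  [/\ forall i j, '[u i, u j] = (i == j)%:R,
      forall x, (forall k, '[x, u k] = 0) -> x = 0,
      forall x k, dom A x -> '[A x, u k] = (l k)%:C * '[x, u k] &
      forall x y, (forall k, '[y, u k] = (l k)%:C * '[x, u k]) -> dom A x /\ A x = y].
Proof.
have [u [u_ortho u_eig u_all]] := orthonormal_eigenvectors.
have A_coord x k : dom A x -> '[A x, u k] = (l k)%:C * '[x, u k].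
  have [du eu] := u_eig k => dx.
  by rewrite self_adjoint_sym// eu ipZr conj_realC.
have u_neq0 k : u k != 0.
  by rewrite -nrm_gt0 (nrm_u norm_ip u_ortho).
have l_resolvent (m : R) (S : H -> H) :
    (forall y, dom A (S y) /\ opshift A m%:C (S y) = y) ->
    forall y k, ((l k)%:C - m%:C) * '[S y, u k] = '[y, u k].
  move=> hS y k; have [dy {2}<-] := hS y.
  by rewrite /= ipBl ipZl A_coord// mulrBl.
have l_far (m : R) k : resolvent_set A m%:C -> (l k)%:C - m%:C != 0 :> R[i].
  move=> rm; rewrite subr_eq0; apply/eqP => e; move: rm; rewrite -e.
  apply: eigenvalue_not_resolvent; have [du eu] := u_eig k.
  by exists (u k) => //; split => //=; rewrite eu subrr.
have complete x : (forall k, '[x, u k] = 0) -> x = 0.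
  apply: (no_eigenvector_trivial norm_ip self_adjoint_sym
    (K := [set x | forall k, '[x, u k] = 0])) => /=.
  - by move=> a y y' hy hy' k; rewrite ipDl ipZl hy hy' mulr0 addr0.
  - move=> y hy k; apply: nrm_eps_eq0 => e /hy[y' hy' h]; apply/ltW.
    apply: le_lt_trans h; have := cauchy_schwarz norm_ip (y - y') (u k).
    by rewrite ipBl hy' subr0 (nrm_u norm_ip u_ortho) mulr1.
  - by move=> k; rewrite ip0l.
  - by move=> y dy hy k; rewrite A_coord// hy mulr0.
  - move=> m S hS y hy k; have /eqP := l_resolvent m S hS y k.
    rewrite hy mulf_eq0 => /orP[/eqP e|/eqP//].
    have [dS eS] := hS (u k).
    have := l_resolvent m S hS (u k) k; rewrite e mul0r u_ortho eqxx => /eqP.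
    by rewrite eq_sym oner_eq0.
  - move=> lambda y dy hy ey; apply/eqP; rewrite -[_ == _]negbK; apply/negP => y0.
    have [k [a ya]] := u_all _ _ dy ey y0; move: y0.
    have := hy k; rewrite {1}ya ipZl u_ortho eqxx mulr1 => a0.
    by rewrite ya a0 scale0r eqxx.
  - exact: spectrum_isolated.
exists u; split => // x y hxy.
have [m rm] := real_resolvent_point spectrum_isolated.
have [S [_ hS _]] := rm.
have xS : x = S (y - m%:C *: x).
  apply: (coord_ext complete) => k; apply: (mulfI (l_far m k rm)).
  by rewrite (l_resolvent m S hS _ k) ipBl ipZl hxy mulrBl.
have [dS eS] := hS (y - m%:C *: x); rewrite -xS in dS eS.
by split => //; move: eS => /= /addIr.
Qed.

End Spectrum.

(** Reduces the three shapes of the index set to sequences. By the last clause,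
    convexity, a bound on the gaps between neighbours bounds all the gaps. *)
Lemma index_set_enumeration (R : realType) (H : completeNormedModType R[i])
    (ip : {dot H for Num.conj}) (A : operator H) :
  exists code : nat -> int, [/\ injective code,
    forall n, index_set ip A n <-> exists k, code k = n &
    forall m n, index_set ip A m -> index_set ip A n -> m < n ->
      index_set ip A (m + 1)].
Proof.
rewrite /index_set; case: ifP => _; [|case: ifP => _].
- exists (fun k => k.+1%:Z); split => [i j [] //|n /=|m n /= m1 _ _]; last by lia.
  split=> [n1|[k <-]]; last by lia.
  by exists `|n|%N.-1; lia.
- exists (fun k => - k.+1%:Z); split => [i j /oppr_inj[] //|n /=|m n /= m1 n1 mn]; last by lia.
  split=> [n1|[k <-]]; last by lia.
  by exists `|n|%N.-1; lia.
- exists (fun k => if odd k then - (k./2.+1)%:Z else k./2%:Z); split => //.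
    move=> i j; have := odd_double_half i; have := odd_double_half j.
    by case: (odd i); case: (odd j) => /=; lia.
  move=> n; split => // _; case: (lerP 0 n) => n0.
    by exists (`|n|.*2)%N; rewrite odd_double doubleK; lia.
  exists (`|n|.-1.*2.+1)%N; rewrite /= odd_double /= uphalf_double; lia.
Qed.

Lemma gap_separated (R : realType) (I : set int) (lam : int -> R) :
  (forall m n, I m -> I n -> m < n -> I (m + 1)) ->
  (forall m n, I m -> I n -> m < n -> lam m < lam n) ->
  forall m n, I m -> I n -> m != n -> gap I lam <= `|lam m - lam n|.
Proof.
move=> Iconv lam_inc.
have gapS m : I m -> I (m + 1) -> gap I lam <= `|lam (m + 1) - lam m|.
  move=> Im Im1; apply: ge_inf; last by exists m.
  by exists 0 => _ [k _ <-].
have lt m n : I m -> I n -> m < n -> gap I lam <= `|lam m - lam n|.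
  move=> Im In mn; have Im1 := Iconv _ _ Im In mn.
  apply: le_trans (gapS _ Im Im1) _.
  have h1 : lam m < lam (m + 1) by apply: lam_inc => //; lia.
  have h2 : lam (m + 1) <= lam n.
    have [<-//|m1n] := eqVneq (m + 1) n.
    by apply/ltW/lam_inc => //; lia.
  by rewrite (distrC (lam m)) !gtr0_norm; lra.
move=> m n Im In; rewrite neq_lt => /orP[mn|nm]; first exact: lt.
by rewrite distrC; exact: lt.
Qed.

(** * Consequences of the enumeration *)

Section Enumeration.
Variables (R : realType) (H : completeNormedModType R[i]).
Variables (B : operator H) (I : set int) (lam : int -> R) (mu : int -> R[i]).
Hypothesis mu_enum : enumerates_with_mult B I mu.
Hypothesis mu_near : forall eps : R, 0 < eps ->
  exists N : nat, forall n, I n -> (N <= `|n|)%N -> `|mu n - (lam n)%:C| < eps%:C.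

(** [r] exceeds the finitely many |mu n| with |n| < N. *)
Lemma far_eigenvalue (N : nat) : exists2 r : R, 0 < r &
  forall z n, r%:C < `|z| -> I n -> mu n = z -> (N <= `|n|)%N.
Proof.
exists (1 + \sum_(k < N) (nrm (mu k%:Z) + nrm (mu (- k%:Z)))).
  by rewrite ltr_wpDr// sumr_ge0// => k _; rewrite addr_ge0 ?nrm_ge0.
move=> z n rz _ nz; rewrite leqNgt; apply/negP => nN; move: rz.
rewrite nrmE ltcR -nz (bigD1 (Ordinal nN))//= ltNge => /negP; apply.
have h : nrm (mu n) <= nrm (mu `|n|%N) + nrm (mu (- (`|n|%N)%:Z)).
  case: (lerP 0 n) => n0.
    have -> : n = `|n|%N :> int by lia.
    by rewrite absz_nat lerDl nrm_ge0.
  have {1}-> : n = - (`|n|%N)%:Z by lia.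
  by rewrite lerDr nrm_ge0.
have : 0 <= \sum_(k < N | k != Ordinal nN) (nrm (mu k%:Z) + nrm (mu (- k%:Z))).
  by apply: sumr_ge0 => k _; rewrite addr_ge0 ?nrm_ge0.
lra.
Qed.

Lemma eigenvalue_index z m : is_eigenvalue B z -> alg_mult B z m ->
  [set n | I n /\ mu n = z] #= `I_m -> exists2 n, I n & mu n = z.
Proof.
move=> ez am card; have m0 := eigenvalue_alg_mult ez am.
apply: contrapT => no.
have e : [set n | I n /\ mu n = z] = set0.
  by apply/seteqP; split => n //= [In nz]; apply: no; exists n.
move: card; rewrite e card_eq_sym card_eq0 => /eqP I0.
by have : `I_m 0%N := m0; rewrite I0.
Qed.

Lemma eigenvalues_localized (eps : R) : 0 < eps -> exists2 r : R, 0 < r &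
  forall z, is_eigenvalue B z -> r%:C < `|z| ->
    exists2 n, I n & `|z - (lam n)%:C| < eps%:C.
Proof.
move=> /mu_near[N hN]; have [r r0 hr] := far_eigenvalue N.
exists r => // z ez rz; have [m am card] := mu_enum z.
have [n In nz] := eigenvalue_index ez am card.
by exists n => //; rewrite -nz; apply: hN => //; exact: (hr z).
Qed.

(** An eigenvalue mu_m = mu_n with m <> n both large would be within d / 2 of
    lam_m and lam_n. *)
Lemma eigenvalues_simple (d : R) : 0 < d ->
  (forall m n, I m -> I n -> m != n -> d <= `|lam m - lam n|) ->
  exists2 r : R, 0 < r & forall z, is_eigenvalue B z -> r%:C < `|z| -> alg_mult B z 1.
Proof.
move=> d0 lam_sep; have [|N hN] := mu_near (eps := d / 2); first by rewrite divr_gt0.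
have [r r0 hr] := far_eigenvalue N.
exists r => // z ez rz; have [m am card] := mu_enum z.
have [n In nz] := eigenvalue_index ez am card.
have e : [set k | I k /\ mu k = z] = [set n].
  apply/seteqP; split => k /=; last by move=> ->.
  move=> [Ik kz]; apply/eqP; rewrite -[_ == _]negbK; apply/negP => kn.
  have := lam_sep _ _ Ik In kn; have := hN _ Ik (hr z _ rz Ik kz).
  have := hN _ In (hr z _ rz In nz); rewrite nz kz !nrm_ltC.
  have := nrm_dist z (lam k)%:C (lam n)%:C; rewrite -rmorphB nrmR (nrmBC (lam k)%:C).
  lra.
suff -> : 1%N = m by [].
apply/card_eq_II; apply: card_eq_trans card; rewrite e card_eq_sym.
exact: card_set1.
Qed.

End Enumeration.

Theorem theorem4p7 (R : realType) (H : completeNormedModType R[i])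
  (ip : {dot H for Num.conj})
  (norm_ip : norm_from_ip ip)
  (H_separable : separable_space H)
  (H_infinite : infinite_dimensional H)
  (A : operator H)
  (A_self_adjoint : self_adjoint ip A)
  (A_spectrum : simple_discrete_spectrum A)
  (lam : int -> R)
  (lam_enum : enumerates_increasingly A (index_set ip A) lam)
  (lam_separated : 0 < gap (index_set ip A) lam) :
  (forall phi psi : H, phi != 0 -> psi != 0 ->
    let I := index_set ip A in
    let B := rank_one_perturbation ip A phi psi in
    [/\ (forall eps : R, 0 < eps ->
          exists2 r : R, 0 < r &
            forall mu : R[i], is_eigenvalue B mu -> r%:C < `|mu| ->
              exists2 n, I n & `|mu - (lam n)%:C| < eps%:C) /\
        (exists2 r : R, 0 < r &
          forall mu : R[i], is_eigenvalue B mu -> r%:C < `|mu| ->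
            alg_mult B mu 1),
        exists2 mu : int -> R[i], enumerates_with_mult B I mu &
          forall eps : R, 0 < eps ->
            exists N : nat, forall n, I n -> (N <= `|n|)%N ->
              `|mu n - (lam n)%:C| < eps%:C &
        (forall z : R[i], is_eigenvalue B z ->
          exists2 k, (k <= 2)%N & geo_mult B z k) /\
        (forall z : R[i], is_eigenvalue B z -> geo_mult B z 2 ->
          is_eigenvalue A z /\ reducing ip (ker (opshift A z)) B)]) /\
  (forall (n : nat) (z : 'I_n -> R[i]) (m : 'I_n -> nat),
    (0 < n)%N -> injective z -> (forall j, (0 < m j)%N) ->
    exists phi psi : H, [/\ phi != 0, psi != 0 &
      forall j, is_eigenvalue (rank_one_perturbation ip A phi psi) (z j) /\
        alg_mult (rank_one_perturbation ip A phi psi) (z j) (m j)]).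
Proof.
have [code [code_inj codeI I_conv]] := index_set_enumeration ip A.
set I := index_set ip A in lam_enum lam_separated codeI I_conv *.
have [lam_inc lam_eig] := lam_enum.
have lam_sep := gap_separated I_conv lam_inc.
have Icode k : I (code k) by apply/codeI; exists k.
pose l k := lam (code k).
have l_sep i j : i != j -> gap I lam <= `|l i - l j|.
  by move=> ij; apply: lam_sep => //; rewrite (inj_eq code_inj).
have l_inj : injective l.
  move=> i j e; apply/eqP; rewrite -[_ == _]negbK; apply/negP => /l_sep.
  by rewrite e subrr normr0 leNgt lam_separated.
have l_eig : [set z | is_eigenvalue A z] = [set (l k)%:C | k in setT].
  rewrite lam_eig; apply/seteqP; split => [_ [n /codeI[k <-] <-]|_ [k _ <-]].
    by exists k.
  by exists (code k).
have [u [u_ortho u_complete A_coord A_dom]] :=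
  eigenbasis norm_ip A_self_adjoint A_spectrum l_inj l_eig.
split=> [phi psi _ _ /=|n z m _ z_inj m0].
  set B := rank_one_perturbation ip A phi psi.
  have [mu0 mu0_near mu0_mult] := perturbed_enumeration norm_ip u_ortho u_complete
    lam_separated l_sep A_coord A_dom phi psi.
  have /choice[idx hidx] : forall n, exists k, I n -> code k = n.
    move=> n; have [/codeI[k kn]|nI] := pselect (I n); first by exists k.
    by exists 0%N.
  pose mu n := mu0 (idx n).
  have mu_code k : mu (code k) = mu0 k.
    by rewrite /mu; congr (mu0 _); apply: code_inj; exact: hidx.
  have mu_enum : enumerates_with_mult B I mu.
    move=> z; have [m am card] := mu0_mult z; exists m => //.
    apply: card_eq_trans card.
    have -> : [set n | I n /\ mu n = z] = code @` [set k | mu0 k = z].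
      apply/seteqP; split => [n [/codeI[k <-]]|_ [k /= kz <-]].
        by rewrite mu_code => kz; exists k.
      by split => //; rewrite mu_code.
    by apply: inj_card_eq => i j _ _; exact: code_inj.
  have mu_near (eps : R) : 0 < eps ->
      exists N : nat, forall n, I n -> (N <= `|n|)%N -> `|mu n - (lam n)%:C| < eps%:C.
    move=> e0; have [|N hN] := mu0_near (eps / 2); first by rewrite divr_gt0.
    exists (\sum_(k < N) `|code k|%N.+1)%N => _ /codeI[k <-] kN.
    rewrite mu_code nrm_ltC; apply: le_lt_trans (hN k _) _; last by lra.
    rewrite leqNgt; apply/negP => kltN; move: kN; rewrite (bigD1 (Ordinal kltN))//=.
    by rewrite addSn ltnNge leq_addr.
  split.
  - split=> [eps e0|]; first exact: (eigenvalues_localized mu_enum mu_near).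
    exact: (eigenvalues_simple mu_enum mu_near lam_separated lam_sep).
  - by exists mu.
  - split=> [z _|z _ h2].
      exact: (geo_mult_le2 u_ortho u_complete lam_separated l_sep A_coord).
    have [k [zk kphi kpsi]] :=
      geo_mult2_decouples u_ortho u_complete lam_separated l_sep A_coord h2.
    split.
      by have : [set z | is_eigenvalue A z] z by rewrite l_eig; exists k.
    rewrite zk; exact: (decoupled_reducing norm_ip u_ortho u_complete lam_separated
      l_sep A_coord A_dom).
have [phi [psi [phi0 psi0 am]]] := prescribed_spectrum u_ortho u_complete lam_separated
  l_sep A_coord A_dom z_inj m0.
exists phi, psi; split => // j; split => //.
by apply: alg_mult_eigenvalue (am j).
Qed.
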